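(* Let $E$ be a (complex) JB$^*$-triple (respectively, a (real) J$^*$B-triple), let $F$ be a normed Jordan triple, and let $T:E\rightarrow F$ be a triple monomorphism, not assumed to be continuous. Then $T$ is bounded below.
   Context: A real (resp., complex) normed Jordan triple is a real (resp., complex) normed space $E$ (not necessarily complete) with a non-trivial (jointly) continuous triple product $E\times E\times E\to E$, $(x,y,z)\mapsto\{x,y,z\}$, which is bilinear and symmetric in the outer variables $x,z$, linear (resp., conjugate linear) in the middle variable $y$, and satisfies the Jordan identity $L(a,b)L(x,y)-L(x,y)L(a,b)=L(L(a,b)x,y)-L(x,L(b,a)y)$ for all $a,b,x,y\in E$, where $L(x,y)z:=\{x,y,z\}$. A Jordan-Banach triple is a normed Jordan triple whose norm is complete. Without further specification, these terms mean a real or complex one. For a normed Jordan triple $E$, $N(E):=\sup\{\|\{x,y,z\}\|:\|x\|,\|y\|,\|z\|\le 1\}$. A (complex) JB$^*$-triple is a complex Jordan-Banach triple $E$ such that (1) for each $a\in E$, $L(a,a)$ is a hermitian operator on $E$ with non-negative spectrum; (2) $\|\{a,a,a\}\|=\|a\|^3$ for all $a\in E$. A (real) J$^*$B-triple is a real Jordan-Banach triple $E$ such that $\|\{a,a,a\}\|=\|a\|^3$ for all $a\in E$; $N(E)=1$; the spectrum of $L(x,x)$ is contained in $[0,+\infty)$ for all $x\in E$; and the spectrum of $L(x,y)-L(y,x)$ is contained in $i\mathbb{R}$ for all $x,y\in E$. Here spectra are complex spectra, i.e. computed in the complexification of the real Banach algebra of bounded linear operators on $E$. A triple homomorphism is a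 linear map $T$ with $T(\{a,b,c\})=\{T(a),T(b),T(c)\}$ for all $a,b,c$ (real-linear if one of the two spaces is real); a triple monomorphism is an injective triple homomorphism. $T$ is bounded below if there is $c>0$ with $\|T(x)\|\ge c\|x\|$ for all $x$. *)

(* Defs.v *)
From HB Require Import structures.
From mathcomp Require Import all_boot all_order all_algebra.
From mathcomp Require Import complex.
From mathcomp Require Import all_classical all_reals all_analysis.

Set Implicit Arguments.
Unset Strict Implicit.
Unset Printing Implicit Defensive.
Import Order.TTheory GRing.Theory Num.Theory.
Import numFieldNormedType.Exports.

Local Open Scope classical_set_scope.
Local Open Scope ring_scope.
Local Open Scope complex_scope.

(** The involution [conj] of the scalar field is the identity for real triples
    and complex conjugation for complex triples.  [tp x y z] is {x,y,z}, so
    that the operator L(x,y) is the partial application [tp x y]. *)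
Record normed_jordan_triple (K : numFieldType) (conj : K -> K)
    (E : normedModType K) (tp : E -> E -> E -> E) : Prop := NormedJordanTriple {
  njt_nontrivial : exists x y z, tp x y z != 0 ;
  njt_continuous : continuous (fun p : E * E * E => tp p.1.1 p.1.2 p.2) ;
  njt_outer_sym : forall x y z, tp x y z = tp z y x ;
  njt_outer_linear : forall k x x' y z,
    tp (k *: x + x') y z = k *: tp x y z + tp x' y z ;
  njt_middle_linear : forall k x y y' z,
    tp x (k *: y + y') z = conj k *: tp x y z + tp x y' z ;
  njt_jordan : forall a b x y z,
    tp a b (tp x y z) - tp x y (tp a b z)
      = tp (tp a b x) y z - tp x (tp b a y) z
}.

Definition real_normed_jordan_triple (R : realType) (E : normedModType R)
    (tp : E -> E -> E -> E) : Prop :=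
  normed_jordan_triple idfun tp.

Definition complex_normed_jordan_triple (R : realType)
    (E : normedModType R[i]) (tp : E -> E -> E -> E) : Prop :=
  normed_jordan_triple (@conjc R) tp.

Definition bounded_operator (K : numFieldType) (E : normedModType K)
    (S : E -> E) : Prop :=
  linear S /\ exists M : K, forall x, `|S x| <= M * `|x|.

Section ComplexOperators.
Context {R : realType} {E : normedModType R[i]}.
Implicit Types (S : E -> E) (f : (E -> E) -> R[i]).

(* The norm of a normed module over [R[i]] takes its (real) values in [R[i]]. *)
Definition cnorm (V : normedModType R[i]) (x : V) : R := complex.Re `|x|.

Definition opnorm S : R := sup [set cnorm (S x) | x in [set x | cnorm x <= 1]].

Definition complex_spectrum S : set R[i] :=
  [set l | ~ exists U : E -> E, bounded_operator U /\
     (forall x, l *: U x - S (U x) = x) /\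
     (forall x, U (l *: x - S x) = x)].

(* Functionals on the Banach algebra BL(E) with norm at most 1 and value 1 at
   the unit; only the values of [f] at bounded operators are relevant. *)
Definition operator_state f : Prop :=
  [/\ forall k S U, bounded_operator S -> bounded_operator U ->
        f (fun x => k *: S x + U x) = k * f S + f U,
      forall S, bounded_operator S -> complex.Re `|f S| <= opnorm S
    & f idfun = 1].

Definition numerical_range S : set R[i] :=
  [set f S | f in operator_state].

Definition hermitian_operator S : Prop :=
  bounded_operator S /\
  forall l, numerical_range S l -> complex.Im l = 0.

End ComplexOperators.

Section RealOperators.
Context {R : realType} {E : normedModType R}.

(* The pair [(A, B)] stands for the element A + iB of the complexification of
   the algebra of bounded operators on [E]. *)
Definition cpl_mul (U V : (E -> E) * (E -> E)) : (E -> E) * (E -> E) :=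
  (fun x => U.1 (V.1 x) - U.2 (V.2 x), fun x => U.1 (V.2 x) + U.2 (V.1 x)).

Definition cpl_one : (E -> E) * (E -> E) := (idfun, fun=> 0).

Definition cpl_invertible (U : (E -> E) * (E -> E)) : Prop :=
  exists V : (E -> E) * (E -> E),
    [/\ bounded_operator V.1, bounded_operator V.2,
        cpl_mul U V = cpl_one & cpl_mul V U = cpl_one].

(* The pair is l - S, for l = Re l + i Im l. *)
Definition real_spectrum (S : E -> E) : set R[i] :=
  [set l | ~ cpl_invertible
     (fun x => complex.Re l *: x - S x, fun x => complex.Im l *: x)].

(* N(E); the set is bounded above when [tp] is a continuous triple product. *)
Definition triple_norm (tp : E -> E -> E -> E) : R :=
  sup [set r | exists x y z,
    [/\ `|x| <= 1, `|y| <= 1, `|z| <= 1 & r = `|tp x y z|]].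

End RealOperators.

(* In the order of [R[i]], [0 <= l] means that [l] is a nonnegative real. *)
Record JBstar_triple (R : realType) (E : completeNormedModType R[i])
    (tp : E -> E -> E -> E) : Prop := JBstarTriple {
  jbs_triple : complex_normed_jordan_triple tp ;
  jbs_hermitian : forall a, hermitian_operator (tp a a) ;
  jbs_positive : forall a l, complex_spectrum (tp a a) l -> 0 <= l ;
  jbs_cube : forall a, `|tp a a a| = `|a| ^+ 3
}.

Record JstarB_triple (R : realType) (E : completeNormedModType R)
    (tp : E -> E -> E -> E) : Prop := JstarBTriple {
  jsb_triple : real_normed_jordan_triple tp ;
  jsb_cube : forall a, `|tp a a a| = `|a| ^+ 3 ;
  jsb_norm : triple_norm tp = 1 ;
  jsb_positive : forall x l, real_spectrum (tp x x) l -> 0 <= l ;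
  jsb_skew : forall x y l,
    real_spectrum (fun z => tp x y z - tp y x z) l -> complex.Re l = 0
}.

Definition real_scale (R : realType) (V : normedModType R[i]) (r : R) (x : V)
  : V := r%:C *: x.

Definition real_linear (R : realType) (E F : zmodType)
    (sE : R -> E -> E) (sF : R -> F -> F) (T : E -> F) : Prop :=
  forall r x y, T (sE r x + y) = sF r (T x) + T y.

Definition triple_monomorphism (E F : Type) (tE : E -> E -> E -> E)
    (tF : F -> F -> F -> F) (T : E -> F) : Prop :=
  injective T /\ forall a b c, T (tE a b c) = tF (T a) (T b) (T c).

Definition bounded_below (R : realType) (E F : Type) (nE : E -> R)
    (nF : F -> R) (T : E -> F) : Prop :=
  exists c : R, 0 < c /\ forall x, c * nE x <= nF (T x).

(* Main.v *)
(** Pulling the norm of F back along T yields a second norm m on E for which the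
    triple product is continuous. For ||a|| = 1 let D = L(a, a); then p(D) a,
    for p a polynomial, corresponds to the odd function x p(x^2) of a. The
    spectral hypothesis, the elementary (Rickart) form of the spectral radius
    formula and ||{x,x,x}|| = ||x||^3 give ||p(D) a|| <= C sup |p| over an
    interval [0, r]; hence f(D) a makes sense for every uniform limit f of
    polynomials on [0, r]. Suppose m(a) is so small that D shrinks m by 1/16
    on the subtriple generated by a. Multiplication by
    h(s) = s / max(|s|, 1/2)^2, which is at most 2 and inverts s on s >= 1/2, is
    not too expanding for m (spectral radius again), so f = f (s h)^j shows
    that f(D) a = 0 whenever f vanishes on s < 1/2. Therefore every f(D) a
    depends only on f on [0, 3/4], and the odd powers a^(3^j), all of norm 1,
    would tend to 0. So m(a) is bounded below. Only real scalars matter, and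
    complex triples are treated by restriction of scalars. *)
Require Import Defs.
From HB Require Import structures.
From mathcomp Require Import all_boot all_order all_algebra.
From mathcomp Require Import complex zify ring lra.
From mathcomp Require Import all_classical all_reals all_analysis.

Set Implicit Arguments.
Unset Strict Implicit.
Unset Printing Implicit Defensive.
Import Order.TTheory GRing.Theory Num.Theory.
Import numFieldNormedType.Exports.

Local Open Scope classical_set_scope.
Local Open Scope ring_scope.
Local Open Scope complex_scope.

(** * Seminorms and polynomials in an operator *)

(** Since T may be discontinuous, the limits that define f(D) a for the norm of E say nothing about
    m, and m need not be complete, so inverses for m cannot come from series. Two facts replace
    this. Multiplication by s g(s) is the triple operator L(g(D) a, a), hence m-bounded for every g,
    though with no control of the bound by sup |g|. And the inverse of multiplication by a function
    q = 1 + s k(s) bounded away from 0 is again of this form, because 1/q = 1 + s k2(s). The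
    spectral radius formula trades such uncontrolled bounds for power-boundedness with one constant
    C, and C is harmless: for m it is beaten by 2^-j, and for the norm of E it disappears under
    3^j-th roots. The formula is therefore proved for an arbitrary seminorm, with invertibility as
    its hypothesis. Complexification is avoided: a point l enters through the real quadratic with
    roots 1/l and 1/(conj l), and a resolvent through its real part. *)

Record seminorm (R : realType) (V : lmodType R) (v : V -> R) : Prop :=
  Seminorm {
  seminormD : forall x y, v (x + y) <= v x + v y ;
  seminormZ : forall k x, v (k *: x) = `|k| * v x }.

Section SeminormTheory.
Context {R : realType} {V : lmodType R} {v : V -> R}.
Hypothesis sv : seminorm v.

Lemma seminorm0 : v 0 = 0.
Proof. by rewrite -(scale0r 0) (seminormZ sv) normr0 mul0r. Qed.

Lemma seminormN x : v (- x) = v x.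
Proof. by rewrite -scaleN1r (seminormZ sv) normrN1 mul1r. Qed.

Lemma seminormB x y : v (x - y) <= v x + v y.
Proof. by rewrite -(seminormN y) (seminormD sv). Qed.

Lemma seminorm_distC x y : v (x - y) = v (y - x).
Proof. by rewrite -seminormN opprB. Qed.

Lemma seminorm_ge0 x : 0 <= v x.
Proof. by have := seminormB x x; rewrite subrr seminorm0; lra. Qed.

Lemma seminorm_sub x y : v x <= v y + v (x - y).
Proof. by rewrite -{1}(subrK y x) addrC (seminormD sv). Qed.

End SeminormTheory.

Section PolynomialAction.
Context {R : realType} {V : lmodType R}.
Implicit Types (X : {linear V -> V}) (p q : {poly R}).

Definition act X p (z : V) : V := \sum_(i < size p) p`_i *: iter i X z.

Lemma act_widen X p n z :
  (size p <= n)%N -> act X p z = \sum_(i < n) p`_i *: iter i X z.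
Proof.
move=> le_pn; rewrite /act (big_ord_widen n (fun i => p`_i *: iter i X z)) //.
rewrite big_mkcond; apply: eq_bigr => i _; case: ltnP => // le_pi.
by rewrite nth_default // scale0r.
Qed.

Lemma actD X p q z : act X (p + q) z = act X p z + act X q z.
Proof.
have le_p : (size p <= maxn (size p) (size q))%N by rewrite leq_maxl.
have le_q : (size q <= maxn (size p) (size q))%N by rewrite leq_maxr.
rewrite (act_widen _ _ le_p) (act_widen _ _ le_q).
rewrite (act_widen _ _ (size_polyD p q)) -big_split; apply: eq_bigr => i _.
by rewrite coefD scalerDl.
Qed.

Lemma actZ X c p z : act X (c *: p) z = c *: act X p z.
Proof.
rewrite (act_widen _ _ (size_scale_leq c p)) /act scaler_sumr.
by apply: eq_bigr => i _; rewrite coefZ scalerA.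
Qed.

Lemma actC X c z : act X c%:P z = c *: z.
Proof. by rewrite (act_widen _ _ (size_polyC_leq1 c)) big_ord1 coefC. Qed.

Lemma act0 X z : act X 0 z = 0.
Proof. by rewrite actC scale0r. Qed.

Lemma actN X p z : act X (- p) z = - act X p z.
Proof. by apply/eqP; rewrite -addr_eq0 -actD addNr act0. Qed.

Lemma actB X p q z : act X (p - q) z = act X p z - act X q z.
Proof. by rewrite actD actN. Qed.

Lemma act1 X z : act X 1 z = z.
Proof. by rewrite actC scale1r. Qed.

Lemma actMX X p z : act X (p * 'X) z = act X p (X z).
Proof.
have le_pX : (size (p * 'X)%R <= (size p).+1)%N.
  by rewrite (leq_trans (size_polyMleq _ _)) // size_polyX addn2.
rewrite (act_widen _ _ le_pX) big_ord_recl coefMX scale0r add0r.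
by apply: eq_bigr => i _; rewrite coefMX -iterSr.
Qed.

Lemma actX X z : act X 'X z = X z.
Proof. by rewrite -(mul1r 'X) actMX act1. Qed.

Lemma act_is_linear X p : linear (act X p).
Proof.
elim/poly_ind: p => [|p c IHp] k y z; first by rewrite !act0 scaler0 addr0.
rewrite !actD !actMX !actC linearP IHp !scalerDr !scalerA (mulrC c).
by rewrite -!addrA; congr (_ + _); rewrite addrCA.
Qed.

HB.instance Definition _ X p :=
  GRing.isLinear.Build R V V _ (act X p) (act_is_linear X p).

Lemma act_comm X p z : act X p (X z) = X (act X p z).
Proof.
elim/poly_ind: p z => [|p c IHp] z; first by rewrite !act0 linear0.
by rewrite !actD !actMX !actC !IHp linearD linearZ.
Qed.

Lemma actM X p q z : act X (p * q) z = act X p (act X q z).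
Proof.
elim/poly_ind: p z => [|p c IHp] z; first by rewrite mul0r !act0.
rewrite mulrDl !actD -mulrA -commr_polyX mulrA !actMX IHp act_comm mul_polyC.
by rewrite actZ actC.
Qed.

Lemma act_comp X p q z : act (act X p) q z = act X (q \Po p) z.
Proof.
elim/poly_ind: q z => [|q c IHq] z; first by rewrite comp_poly0 !act0.
by rewrite comp_polyD comp_polyM comp_polyX comp_polyC !actD actMX IHq actM !actC.
Qed.

Lemma act_Xn X n z : act X 'X^n z = iter n X z.
Proof. by elim: n => [|n IHn]; rewrite ?act1 // exprSr actMX act_comm IHn. Qed.

End PolynomialAction.

(** * The spectral radius *)

Section SpectralRadius.
Context {R : realType} {V : lmodType R} (v : V -> R).
Hypothesis sv : seminorm v.
Implicit Types (X : {linear V -> V}) (al be r : R).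

Definition op_bounded (S : V -> V) : Prop :=
  exists C, forall z, v (S z) <= C * v z.

Definition op_inverse (S U : V -> V) : Prop :=
  [/\ op_bounded U, cancel U S & cancel S U].

(* With l = al + i be this is (1 - l p)(1 - l^* p). *)
Definition quadp al be (p : {poly R}) : {poly R} :=
  1 - (2 * al)%:P * p + (al ^+ 2 + be ^+ 2)%:P * p ^+ 2.

(** Half-angle formulas for a square root of c + i s. A point of the circle at exponent 2^(k+1) is
    thereby reached from two opposite points at exponent 2^k. *)
Lemma circle_sqrt (c s : R) : c ^+ 2 + s ^+ 2 = 1 ->
  exists a b, [/\ a ^+ 2 + b ^+ 2 = 1, a ^+ 2 - b ^+ 2 = c & 2 * a * b = s].
Proof.
move=> cs1.
have c_ge : 0 <= (1 + c) / 2 by have := sqr_ge0 s; nra.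
have c_le : 0 <= (1 - c) / 2 by have := sqr_ge0 s; nra.
set a := Num.sqrt ((1 + c) / 2); set b := Num.sqrt ((1 - c) / 2).
have a2 : a ^+ 2 = (1 + c) / 2 by rewrite sqr_sqrtr.
have b2 : b ^+ 2 = (1 - c) / 2 by rewrite sqr_sqrtr.
have s2 : (2 * a * b) ^+ 2 = s ^+ 2.
  by rewrite !exprMn a2 b2; have := cs1; move/(canRL (addKr _)) => ->; lra.
have /orP[/eqP e|/eqP e] : (2 * a * b == s) || (2 * a * b == - s).
- by rewrite -eqf_sqr s2.
- by exists a, b; rewrite a2 b2; split=> //; lra.
by exists a, (- b); rewrite sqrrN a2 b2; split=> //; lra.
Qed.

Definition circlep r k (c s : R) : {poly R} :=
  quadp (r ^+ (2 ^ k) * c) (r ^+ (2 ^ k) * s) 'X^(2 ^ k).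

(** With l = r^(2^k) (c + i s) and Y = 'X^(2^k), the real part of (1 - l Y)^-1 is this numerator
    over [circlep]: multiply above and below by 1 - (conj l) Y. *)
Definition circle_num r k (c : R) : {poly R} :=
  1 - (r ^+ (2 ^ k) * c)%:P * 'X^(2 ^ k).

Lemma circlepS r k (a b : R) :
  circlep r k.+1 (a ^+ 2 - b ^+ 2) (2 * a * b) =
  circlep r k a b * circlep r k (- a) (- b).
Proof. by rewrite /circlep expnSr !exprM /quadp; ring. Qed.

(* For l = r^(2^k) (c + i s), A1 and A2 are the real parts of
   (1 - l X^(2^k))^-1 for r = r1 and r = r2. *)
Definition circle_close X (eps r1 r2 : R) (k : nat) : Prop :=
  forall c s, c ^+ 2 + s ^+ 2 = 1 ->
  [/\ forall w, exists z, act X (circlep r1 k c s) z = w,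
      forall w, exists z, act X (circlep r2 k c s) z = w &
      exists A1 A2 : V -> V,
      [/\ forall z, A1 (act X (circlep r1 k c s) z) = act X (circle_num r1 k c) z,
          forall z, A2 (act X (circlep r2 k c s) z) = act X (circle_num r2 k c) z &
          forall w, v (A1 w - A2 w) <= eps * v w]].

(* The real part of (1 - l^2 Y^2)^-1 is the mean of those of (1 - l Y)^-1 and
   (1 + l Y)^-1. *)
Lemma circle_closeS X eps r1 r2 k :
  circle_close X eps r1 r2 k -> circle_close X eps r1 r2 k.+1.
Proof.
move=> IH c s /circle_sqrt [a [b [ab1 <- <-]]] /=.
have [|onto1 onto2 [A1 [A2 [A1E A2E A12]]]] := IH a b; first by [].
have [|onto1' onto2' [B1 [B2 [B1E B2E B12]]]] := IH (- a) (- b).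
  by rewrite !sqrrN.
have meanE r (A B : V -> V) :
    (forall z, A (act X (circlep r k a b) z) = act X (circle_num r k a) z) ->
    (forall z, B (act X (circlep r k (- a) (- b)) z) =
               act X (circle_num r k (- a)) z) ->
    forall z, let w := act X (circlep r k.+1 (a ^+ 2 - b ^+ 2) (2 * a * b)) z in
    2^-1 *: (A w + B w) = act X (circle_num r k.+1 (a ^+ 2 - b ^+ 2)) z.
  move=> AE BE z w; have -> : A w = act X (circle_num r k a *
      circlep r k (- a) (- b)) z by rewrite /w circlepS !actM AE.
  have -> : B w = act X (circle_num r k (- a) * circlep r k a b) z.
    by rewrite /w circlepS mulrC !actM BE.
  rewrite -actD -actZ; congr act.
  rewrite /circle_num /circlep /quadp expnSr !exprM.
  set lhs := (X in _ *: X); set rhs := RHS.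
  have -> : lhs = rhs *+ 2 by rewrite /lhs /rhs; ring.
  have half2 : 2^-1 + 2^-1 = 1 :> R by lra.
  by rewrite mulr2n scalerDr -scalerDl half2 scale1r.
split.
- move=> w; have [y <-] := onto1 w; have [z <-] := onto1' y.
  by exists z; rewrite circlepS actM.
- move=> w; have [y <-] := onto2 w; have [z <-] := onto2' y.
  by exists z; rewrite circlepS actM.
exists (fun w => 2^-1 *: (A1 w + B1 w)), (fun w => 2^-1 *: (A2 w + B2 w)).
split; [exact: meanE|exact: meanE|move=> w].
rewrite -scalerBr opprD addrACA (seminormZ sv) gtr0_norm ?invr_gt0 //.
by have := seminormD sv (A1 w - A2 w) (B1 w - B2 w); have := A12 w; have := B12 w; lra.
Qed.

Definition quad_lower_bound X al be (C : R) : Prop :=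
  forall z, v z <= C * v (act X (quadp al be 'X) z).

Lemma quad_diff X (B : R) al be al' be' z : 0 <= B ->
  (forall z, v (X z) <= B * v z) ->
  v (act X (quadp al be 'X) z - act X (quadp al' be' 'X) z) <=
    (2 * `|al - al'| * B + `|al ^+ 2 + be ^+ 2 - (al' ^+ 2 + be' ^+ 2)| * B ^+ 2)
      * v z.
Proof.
move=> B0 XB; rewrite -actB.
have -> : quadp al be 'X - quadp al' be' 'X = (2 * (al' - al)) *: 'X
    + (al ^+ 2 + be ^+ 2 - (al' ^+ 2 + be' ^+ 2)) *: ('X * 'X).
  by rewrite /quadp -!mul_polyC; ring.
rewrite actD !actZ actM !actX (le_trans (seminormD sv _ _)) //.
rewrite !(seminormZ sv) normrM distrC gtr0_norm //.
have XX : v (X (X z)) <= B ^+ 2 * v z.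
  by rewrite (le_trans (XB _)) // expr2 -mulrA ler_wpM2l.
rewrite [leRHS]mulrDl; apply: lerD; last by rewrite -mulrA ler_wpM2l.
by rewrite -!mulrA; do 2! apply: ler_wpM2l => //.
Qed.

(** Compactness of the square: a bounded inverse at one point gives a lower bound there, and nearby
    points keep it with twice the constant because the quadratic depends continuously on its
    coefficients. *)
Lemma quad_lower_bound_unif X : op_bounded X ->
  (forall al be, `|al| <= 2 -> `|be| <= 2 ->
     exists U, op_inverse (act X (quadp al be 'X)) U) ->
  exists C, forall al be, `|al| <= 2 -> `|be| <= 2 -> quad_lower_bound X al be C.
Proof.
case=> B0 XB0 inv.
pose B := Num.max B0 0.
have B_ge0 : 0 <= B by rewrite le_max lexx orbT.
have XB z : v (X z) <= B * v z.
  rewrite (le_trans (XB0 z)) // ler_wpM2r ?(seminorm_ge0 sv) //.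
  by rewrite le_max lexx.
have cK : compact (`[-2, 2]%classic `*` `[-2, 2]%classic : set (R * R)).
  by apply: compact_setX; apply: segment_compact.
have /compact_near_coveringP cov := cK.
(* The constant runs along the filter at infinity, so the local constants merge into a single one
   for the whole square. *)
have [] := cov R (pinfty_nbhs R) (fun C ab => quad_lower_bound X ab.1 ab.2 C) _.
  move=> [al be] /= [].
  rewrite !in_itv /= -!ler_norml => al2 be2.
  have [U [[C0 UC0] UK KU]] : exists U, op_inverse (act X (quadp al be 'X)) U.
    exact: inv.
  pose C := Num.max C0 1.
  have C_gt0 : 0 < C by rewrite lt_max ltr01 orbT.
  have lb : quad_lower_bound X al be C.
    move=> z; rewrite -{1}(KU z) (le_trans (UC0 _)) //.
    by rewrite ler_wpM2r ?(seminorm_ge0 sv) // le_max lexx.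
  have C_ge1 : 1 <= C by rewrite le_max lexx orbT.
  (* Moving the point by less than e changes the quadratic by at most e L; the 10 comes from two
     squares, each changing by at most 5 e. The choice C L e = 1/2 lets this change be absorbed on
     the left. *)
  pose L := 2 * B + 10 * B ^+ 2 + 1.
  have L_ge1 : 1 <= L by rewrite /L; have := sqr_ge0 B; lra.
  have L_gt0 : 0 < L by lra.
  pose e := (2 * (C * L))^-1.
  have e_gt0 : 0 < e by rewrite invr_gt0 !mulr_gt0.
  have CLe : C * L * e = 2^-1.
    by rewrite /e; field; rewrite !gt_eqF.
  have CL_ge1 : 1 <= C * L by rewrite mulr_ege1.
  have e_le : e <= 2^-1 by rewrite -CLe ler_peMl // ltW.
  exists (ball (al, be) e, [set C' | 2 * C < C']).
    by split; [exact: nbhsx_ballx|exists (2 * C); split => //; rewrite num_real].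
  move=> [[al' be'] C'] /= [[]].
  rewrite /ball /= /ball /= => al_near be_near lt_C z.
  have := quad_diff al be al' be' z B_ge0 XB.
  set d := v (_ - _) => d_le.
  have {}d_le : d <= e * L * v z.
    apply: le_trans d_le _; rewrite ler_wpM2r ?(seminorm_ge0 sv) //.
    have -> : e * L = 2 * e * B + 10 * e * B ^+ 2 + e by rewrite /L; ring.
    have sq_diff (x y : R) : `|x| <= 2 -> `|x - y| < e ->
        `|x ^+ 2 - y ^+ 2| <= 5 * e.
      move=> x2 xy; rewrite subr_sqr normrM.
      have : `|x + y| <= 5.
        have -> : x + y = (x + x) - (x - y) by ring.
        rewrite (le_trans (ler_normB _ _)) // (le_trans (lerD (ler_normD _ _)
          (lexx _))) //.
        lra.
      by have := normr_ge0 (x - y); have := normr_ge0 (x + y); nra.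
    have dal := sq_diff _ _ al2 al_near; have dbe := sq_diff _ _ be2 be_near.
    have {dal dbe} : `|al ^+ 2 + be ^+ 2 - (al' ^+ 2 + be' ^+ 2)| <= 10 * e.
      by rewrite opprD addrACA (le_trans (ler_normD _ _)) //; lra.
    by have := sqr_ge0 B; nra.
  have := lb z; have := seminorm_sub sv (act X (quadp al be 'X) z) (act X (quadp
    al' be' 'X) z).
  rewrite -/d; set q := v (act _ _ _); set q' := v (act _ _ _) => qq' zq.
  have q'0 : 0 <= q' by apply: seminorm_ge0.
  have z0 : 0 <= v z by apply: seminorm_ge0.
  have : v z <= C * q' + C * L * e * v z by have := seminorm_ge0 sv z; nra.
  by rewrite CLe; nra.
move=> M [_ MC]; exists (M + 1) => al be al2 be2.
apply: (MC (M + 1) _ (al, be)); first by rewrite ltrDl.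
by split; rewrite /= in_itv /= -ler_norml.
Qed.

(** Convergence of (r X)^(2^k) to 0 in operator norm, along the only exponents that [circle_closeS]
    produces. *)
Definition small_powers X r : Prop :=
  forall d, 0 < d -> exists K, forall k, (K <= k)%N -> forall z,
    r ^+ (2 ^ k) * v (act X 'X^(2 ^ k) z) <= d * v z.

(** Averaging does not enlarge the gap 1/8, so it persists at every exponent 2^k. For large k the
    resolvent for r1 is close to the identity; then so is the one for r2, and therefore also its
    inverse 1 - (r2 X)^(2^k). *)
Lemma small_powers_step X r1 r2 : 0 <= r1 -> 0 <= r2 ->
  circle_close X 8^-1 r1 r2 0 -> small_powers X r1 ->
  exists K, forall k, (K <= k)%N -> forall z,
    r2 ^+ (2 ^ k) * v (act X 'X^(2 ^ k) z) <= 2^-1 * v z.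
Proof.
move=> r1_ge0 r2_ge0 close0 /(_ 8^-1) []; first by rewrite invr_gt0.
move=> K small1; exists K => k /small1 {}small1 z.
have close : circle_close X 8^-1 r1 r2 k.
  by elim: k {small1} => // k; apply: circle_closeS.
have [|onto1 onto2 [A1 [A2 [A1E A2E A12]]]] := close 1 0; first by ring.
(* At the real point of the circle the two conjugate factors coincide, so [A1] and [A2] are genuine
   inverses of [circle_num]. *)
have circleE r : circlep r k 1 0 = circle_num r k 1 * circle_num r k 1.
  by rewrite /circlep /quadp /circle_num; ring.
have numE r u : act X (circle_num r k 1) u = u - r ^+ (2 ^ k) *: act X 'X^(2 ^ k) u.
  by rewrite /circle_num actB act1 mulr1 mul_polyC actZ.
have half_onto r : (forall w, exists z, act X (circlep r k 1 0) z = w) ->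
    forall w, exists u, act X (circle_num r k 1) u = w.
  by move=> onto w; have [u <-] := onto w; rewrite circleE actM; eexists.
have half_inv r A : (forall w, exists z, act X (circlep r k 1 0) z = w) ->
    (forall z, A (act X (circlep r k 1 0) z) = act X (circle_num r k 1) z) ->
    forall u, A (act X (circle_num r k 1) u) = u.
  by move=> onto AE u; have [u' <-] := half_onto r onto u; rewrite -actM -circleE AE.
have vscale r u : 0 <= r ->
    v (r ^+ (2 ^ k) *: act X 'X^(2 ^ k) u) = r ^+ (2 ^ k) * v (act X 'X^(2 ^ k) u).
  by move=> r_ge0; rewrite (seminormZ sv) ger0_norm ?exprn_ge0.
set w := act X (circle_num r2 k 1) z.
have [u wE] := half_onto _ onto1 w.
have A1w : A1 w = u by rewrite -wE half_inv.
have A2w : A2 w = z by rewrite half_inv.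
have := A12 w; rewrite A1w A2w => uz.
have uw : v (u - w) <= 8^-1 * v u.
  by rewrite -wE numE opprB addrC subrK vscale.
have zw : z - w = r2 ^+ (2 ^ k) *: act X 'X^(2 ^ k) z.
  by rewrite /w numE opprB addrC subrK.
rewrite -vscale // -zw.
have := seminorm_sub sv u w; have := seminorm_sub sv w z.
have : v (z - w) <= v (u - z) + v (u - w).
  rewrite (seminorm_distC sv u); have -> : z - w = (z - u) + (u - w).
    by rewrite addrA subrK.
  exact: seminormD.
by rewrite (seminorm_distC sv w z); have := seminorm_ge0 sv z; lra.
Qed.

Lemma small_powers_scale X r q : 0 <= r -> 0 <= q < 1 ->
  (exists K, forall k, (K <= k)%N -> forall z,
    r ^+ (2 ^ k) * v (act X 'X^(2 ^ k) z) <= 2^-1 * v z) ->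
  small_powers X (q * r).
Proof.
move=> r_ge0 /andP[q_ge0 q_lt1] [K HK] d d_gt0.
have /cvgrPdist_lt /(_ _ d_gt0) [K' _ HK'] : q ^+ n @[n --> \oo] --> 0.
  by apply: cvg_expr; rewrite ger0_norm.
exists (maxn K K') => k; rewrite geq_max => /andP[leK leK'] z.
have /HK' /= : (K' <= 2 ^ k)%N by rewrite (leq_trans leK') // ltnW // ltn_expl.
rewrite sub0r normrN ger0_norm ?exprn_ge0 // => qd.
have := HK k leK z; rewrite exprMn -mulrA => le_half.
have := seminorm_ge0 sv z; have : 0 <= q ^+ (2 ^ k) by rewrite exprn_ge0.
by nra.
Qed.

(* Rickart's elementary form of the spectral radius formula. *)
Lemma power_bounded X : op_bounded X ->
  (forall al be, `|al| <= 2 -> `|be| <= 2 ->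
     exists U, op_inverse (act X (quadp al be 'X)) U) ->
  exists C, forall n z, v (act X 'X^n z) <= C * v z.
Proof.
move=> Xb inv.
have [C0 lb0] := quad_lower_bound_unif Xb inv.
have [C C_ge0 lb] : exists2 C, 0 <= C &
    forall al be, `|al| <= 2 -> `|be| <= 2 -> quad_lower_bound X al be C.
  exists (Num.max C0 0); first by rewrite le_max lexx orbT.
  move=> al be al2 be2 z; rewrite (le_trans (lb0 _ _ al2 be2 z)) //.
  by rewrite ler_wpM2r ?(seminorm_ge0 sv) // le_max lexx.
have [B B_ge0 XB] : exists2 B, 0 <= B & forall z, v (X z) <= B * v z.
  case: Xb => B0 XB0; exists (Num.max B0 0); first by rewrite le_max lexx orbT.
  move=> z; rewrite (le_trans (XB0 z)) // ler_wpM2r ?(seminorm_ge0 sv) //.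
  by rewrite le_max lexx.
(* The uniform lower bound makes the real part of (1 - l X)^-1 Lipschitz in the radius, with
   constant [K]; one step length [h] thus serves all radii up to 2. *)
have close0 : exists2 h, 0 < h & forall r1 r2, 0 <= r1 <= 2 -> 0 <= r2 <= 2 ->
    `|r1 - r2| <= h -> circle_close X 8^-1 r1 r2 0.
  pose K := (1 + 2 * B) * C ^+ 2 * (2 * B + 4 * B ^+ 2) + B * C.
  have K_ge0 : 0 <= K.
    by rewrite addr_ge0 ?mulr_ge0 ?exprn_ge0 ?addr_ge0 ?mulr_ge0 ?exprn_ge0.
  exists (8 * (K + 1))^-1; first by rewrite invr_gt0; lra.
  move=> r1 r2 r1_in r2_in; set h := _^-1 => r12 c s cs1.
  have h_ge0 : 0 <= h by rewrite invr_ge0; lra.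
  have hK : h * K <= 8^-1.
    by rewrite ler_pdivrMl; lra.
  have c1 : `|c| <= 1 by rewrite -(@expr_le1 _ 2) // real_normK ?num_real //;
    have := sqr_ge0 s; lra.
  have s1 : `|s| <= 1 by rewrite -(@expr_le1 _ 2) // real_normK ?num_real //;
    have := sqr_ge0 c; lra.
  have in2 r x : 0 <= r <= 2 -> `|x| <= 1 -> `|r ^+ (2 ^ 0) * x| <= 2.
    move=> /andP[r0 r2']; rewrite expr1 normrM (ger0_norm r0).
    by have := normr_ge0 x; nra.
  have [U1 [[M1 U1b] U1K K1U]] := inv _ _ (in2 _ _ r1_in c1) (in2 _ _ r1_in s1).
  have [U2 [[M2 U2b] U2K K2U]] := inv _ _ (in2 _ _ r2_in c1) (in2 _ _ r2_in s1).
  split.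
  - by move=> w; exists (U1 w); rewrite /circlep expr1 U1K.
  - by move=> w; exists (U2 w); rewrite /circlep expr1 U2K.
  exists (fun w => act X (circle_num r1 0 c) (U1 w)).
  exists (fun w => act X (circle_num r2 0 c) (U2 w)).
  split; [by move=> z; rewrite /circlep expr1 K1U|
          by move=> z; rewrite /circlep expr1 K2U|move=> w].
  have numE r u : act X (circle_num r 0 c) u = u - (r * c) *: X u.
    by rewrite /circle_num actB act1 mul_polyC actZ !expr1 actX.
  rewrite !numE.
  set u1 := U1 w; set u2 := U2 w.
  have -> : u1 - (r1 * c) *: X u1 - (u2 - (r2 * c) *: X u2) =
      (u1 - u2) - ((r1 * c) *: X (u1 - u2) + ((r1 - r2) * c) *: X u2).
    rewrite (linearB X) scalerBr mulrBl scalerBl addrA subrK !opprD !opprK.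
    by rewrite [LHS]addrACA.
  have r12c x : `|x| <= 1 -> `|r1 * x - r2 * x| <= h.
    by move=> x1; rewrite -mulrBl normrM (le_trans _ r12) // ler_piMr.
  have u2_le : v u2 <= C * v w.
    have := lb _ _ (in2 _ _ r2_in c1) (in2 _ _ r2_in s1) u2.
    by rewrite U2K.
  have q1u1 := U1K w; rewrite -/u1 in q1u1.
  have q2u2 := U2K w; rewrite -/u2 in q2u2.
  set D := v (u1 - u2).
  have D_le : D <= C * ((2 * h * B + 4 * h * B ^+ 2) * v u2).
    have := lb _ _ (in2 _ _ r1_in c1) (in2 _ _ r1_in s1) (u1 - u2).
    rewrite (linearB (act X _)) /= q1u1 -{1}q2u2 => /le_trans; apply.
    rewrite ler_wpM2l // (le_trans (quad_diff _ _ _ _ _ B_ge0 XB)) //.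
    rewrite ler_wpM2r ?(seminorm_ge0 sv) // !expr1.
    rewrite lerD // ler_wpM2r ?exprn_ge0 //.
      by rewrite ler_wpM2l // distrC r12c.
    rewrite !exprMn -!mulrDr cs1 !mulr1 subr_sqr normrM (distrC r2).
    have : `|r2 + r1| <= 4 by rewrite ger0_norm ?addr_ge0; lra.
    by have := normr_ge0 (r1 - r2); have := normr_ge0 (r2 + r1); nra.
  have Bu2 : v (((r1 - r2) * c) *: X u2) <= h * B * v u2.
    rewrite (seminormZ sv) mulrBl -mulrA.
    by apply: ler_pM; rewrite ?normr_ge0 ?(seminorm_ge0 sv) ?r12c.
  have BD : v ((r1 * c) *: X (u1 - u2)) <= 2 * B * D.
    rewrite (seminormZ sv) -mulrA.
    apply: ler_pM; rewrite ?normr_ge0 ?(seminorm_ge0 sv) //.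
    by have := in2 _ _ r1_in c1; rewrite expr1.
  apply: (@le_trans _ _ (h * K * v w)); last first.
    by rewrite ler_wpM2r ?(seminorm_ge0 sv).
  apply: (@le_trans _ _ ((1 + 2 * B) * D + h * B * v u2)).
    rewrite (le_trans (seminormB sv _ _)) // -/D.
    by have := seminormD sv ((r1 * c) *: X (u1 - u2)) (((r1 - r2) * c) *: X u2); lra.
  have -> : h * K * v w = (1 + 2 * B) * (C * ((2 * h * B + 4 * h * B ^+ 2) *
    (C * v w))) + h * B * (C * v w) by rewrite /K; ring.
  apply: lerD; last by rewrite ler_wpM2l // mulr_ge0.
  rewrite ler_wpM2l ?addr_ge0 ?mulr_ge0 // (le_trans D_le) // !ler_wpM2l //.
  by rewrite addr_ge0 ?mulr_ge0 ?exprn_ge0.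
have [h h_gt0 close_h] := close0.
pose N := (Num.bound (2 / h)).+1.
have N_gt : 2 < N%:R * h.
  rewrite -ltr_pdivrMr // (lt_trans (archi_boundP _)) ?ltr_nat //.
  by rewrite divr_ge0 // ltW.
have N_gt0 : 0 < N%:R :> R by rewrite ltr0n.
have small i : (i <= N)%N -> small_powers X (i%:R / N%:R).
  elim: i => [_|i IHi lt_iN].
    move=> d d_gt0; exists 0%N => k _ z.
    by rewrite mul0r expr0n expn_eq0 mul0r mulr_ge0 ?(seminorm_ge0 sv) // ltW.
  (* Overshoot to (i+2)/N, where only the bound 1/2 is known, then shrink back to (i+1)/N, which
     turns that bound into decay. The overshoot past radius 1 is why the hypothesis covers more than
     the unit disc. *)
  have -> : i.+1%:R / N%:R = (i.+1%:R / i.+2%:R) * (i.+2%:R / N%:R) :> R.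
    by rewrite mulrA divfK ?pnatr_eq0.
  apply: small_powers_scale; rewrite ?divr_ge0 //=.
    by rewrite ltr_pdivrMr ?ltr0n // mul1r ltr_nat.
  apply: (@small_powers_step _ (i%:R / N%:R)); rewrite ?divr_ge0 //.
    have N_ge1 : 1 <= N%:R :> R by rewrite ler1n.
    have iN : i%:R + 1 <= N%:R :> R by rewrite natr1 ler_nat.
    apply: close_h; rewrite ?divr_ge0 //=.
    - by rewrite ler_pdivrMr //; lra.
    - by rewrite ler_pdivrMr // -addn2 natrD; lra.
    - rewrite -mulrBl -addn2 natrD opprD addNKr normrM normrN !ger0_norm ?invr_ge0 //.
      by rewrite ler_pdivrMr // mulrC ltW.
  by apply: IHi; apply: ltnW.
have {small} : small_powers X 1 by have := small N (leqnn N); rewrite divff ?pnatr_eq0.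
(* One power 'X^M that does not expand v is enough: dividing any exponent by M leaves a remainder
   below M. *)
move=> /(_ 1 ltr01) [k] /(_ k (leqnn k)).
set M := (2 ^ k)%N => XM.
pose B' := Num.max B 1.
have B'_ge1 : 1 <= B' by rewrite le_max lexx orbT.
have XB' n z : v (act X 'X^n z) <= B' ^+ n * v z.
  elim: n z => [|n IHn] z; first by rewrite expr0 act1 mul1r.
  rewrite exprSr actM actX (le_trans (IHn _)) // exprSr -mulrA.
  rewrite ler_wpM2l ?exprn_ge0 ?(le_trans ler01) // (le_trans (XB z)) //.
  by rewrite ler_wpM2r ?(seminorm_ge0 sv) // le_max lexx.
exists (B' ^+ M) => n z.
rewrite (divn_eq n M); elim: (n %/ M)%N => [|q IHq].
  rewrite mul0n add0n (le_trans (XB' _ _)) // ler_wpM2r ?(seminorm_ge0 sv) //.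
  by rewrite ler_weXn2l // ltnW // ltn_mod expn_gt0.
rewrite mulSn -addnA exprD actM (le_trans _ IHq) //.
by have := XM (act X 'X^(q * M + n %% M) z); rewrite expr1n !mul1r.
Qed.

End SpectralRadius.

(** * Inverting polynomials in an operator *)

Definition complete_norm (R : realType) (V : lmodType R) (n : V -> R) : Prop :=
  forall u : nat -> V,
    (forall e, 0 < e ->
       exists K, forall i j, (K <= i)%N -> (K <= j)%N -> n (u i - u j) <= e) ->
    exists l, forall e, 0 < e -> exists K, forall i, (K <= i)%N -> n (u i - l) <= e.

Definition invertible_op (R : realType) (V : lmodType R) (v : V -> R)
  (S : V -> V) : Prop := exists U, op_inverse v S U.

(** Real form of the inclusion of the spectrum in [0, +oo): the quadratic is (X - l)(X - conj l) for
    the non-real point l = al + i be. *)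
Definition nonneg_spectrum (R : realType) (V : lmodType R) (v : V -> R)
    (X : {linear V -> V}) : Prop :=
  (forall al, al < 0 -> invertible_op v (act X ('X - al%:P))) /\
  (forall al be, be != 0 ->
     invertible_op v (act X (('X - al%:P) ^+ 2 + (be ^+ 2)%:P))).

Section Invertibility.
Context {R : realType} {V : lmodType R} (n : V -> R).
Hypothesis sn : seminorm n.
Hypothesis n_eq0 : forall x, n x = 0 -> x = 0.
Hypothesis n_complete : complete_norm n.
Implicit Types (X : {linear V -> V}) (p q : {poly R}).

Lemma op_bounded_pos (S : V -> V) : op_bounded n S ->
  exists2 C, 0 < C & forall z, n (S z) <= C * n z.
Proof.
case=> C0 SC0; exists (Num.max C0 1); first by rewrite lt_max ltr01 orbT.
move=> z; rewrite (le_trans (SC0 z)) // ler_wpM2r ?(seminorm_ge0 sn) //.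
by rewrite le_max lexx.
Qed.

Lemma op_bounded_comp (S S' : V -> V) :
  op_bounded n S -> op_bounded n S' -> op_bounded n (S \o S').
Proof.
move=> /op_bounded_pos [C C0 SC] [C' SC']; exists (C * C') => z /=.
by rewrite (le_trans (SC _)) // -mulrA ler_wpM2l // ltW.
Qed.

Lemma invertible_actM X p q : invertible_op n (act X p) ->
  invertible_op n (act X q) -> invertible_op n (act X (p * q)).
Proof.
move=> [U [Ub pU Up]] [W [Wb qW Wq]]; exists (W \o U); split.
- exact: op_bounded_comp.
- by move=> z; rewrite actM /= qW pU.
by move=> z; rewrite actM /= Up Wq.
Qed.

Lemma invertible_actC X c : c != 0 -> invertible_op n (act X c%:P).
Proof.
move=> c0; exists (fun z => c^-1 *: z); split.
- by exists `|c^-1| => z; rewrite (seminormZ sn).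
- by move=> z; rewrite actC scalerA divff // scale1r.
by move=> z; rewrite actC scalerA mulVf // scale1r.
Qed.

Lemma onto_invertible (S : {linear V -> V}) C :
  (forall w, exists z, S z = w) -> (forall z, n z <= C * n (S z)) ->
  invertible_op n S.
Proof.
move=> /choice [U SU] lb; exists U; split => [|z|z]; first by exists C => z;
  rewrite -{2}(SU z).
  exact: SU.
apply/eqP; rewrite -subr_eq0; apply/eqP/n_eq0/le_anti.
rewrite (seminorm_ge0 sn) andbT (le_trans (lb _)) // linearB SU subrr.
by rewrite (seminorm0 sn) mulr0.
Qed.

(** A fixed point of the contraction z |-> r^-1 (X z - w) solves X z - r z = w; completeness
    supplies it as the limit of the iterates from 0. *)
Lemma neumann X (b r : R) : 0 <= b < r -> (forall z, n (X z) <= b * n z) ->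
  invertible_op n (act X ('X - r%:P)).
Proof.
move=> /andP[b_ge0 b_lt_r] Xb.
have r_gt0 : 0 < r by apply: le_lt_trans b_ge0 b_lt_r.
have actE z : act X ('X - r%:P) z = X z - r *: z by rewrite actB actX actC.
have lb z : n z <= (r - b)^-1 * n (act X ('X - r%:P) z).
  rewrite ler_pdivlMl ?subr_gt0 // actE (seminorm_distC sn).
  have := seminorm_sub sn (r *: z) (X z); rewrite (seminormZ sn) gtr0_norm //.
  by have := Xb z; lra.
apply: (onto_invertible _ lb) => w.
pose f z := r^-1 *: (X z - w); pose u k := iter k f 0; pose q := b / r.
have q_ge0 : 0 <= q by rewrite divr_ge0 // ltW.
have q_lt1 : q < 1 by rewrite ltr_pdivrMr // mul1r.
have f_contract y z : n (f y - f z) <= q * n (y - z).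
  rewrite /f -scalerBr opprB addrA subrK -linearB (seminormZ sn).
  rewrite gtr0_norm ?invr_gt0 // /q mulrAC [leRHS]mulrC.
  by rewrite ler_wpM2l // invr_ge0 ltW.
have iter_contract k y z : n (iter k f y - iter k f z) <= q ^+ k * n (y - z).
  elim: k => [|k IHk] /=; first by rewrite mul1r.
  by rewrite (le_trans (f_contract _ _)) // exprS -mulrA ler_wpM2l.
pose M := n (u 1%N) / (1 - q).
have u_le j : n (u j) <= M.
  have q1 : 0 < 1 - q by rewrite subr_gt0.
  have M_eq : M * (1 - q) = n (u 1%N) by rewrite /M divfK // gt_eqF.
  elim: j => [|j IHj].
    by rewrite (seminorm0 sn) divr_ge0 ?(seminorm_ge0 sn) // ltW.
  have := seminorm_sub sn (u j.+1) (u 1%N); have := f_contract (u j) 0.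
  rewrite subr0 -[f (u j)]/(u j.+1) -[f 0]/(u 1%N).
  by nra.
have u_cauchy k j : n (u (k + j)%N - u k) <= q ^+ k * M.
  rewrite /u iterD (le_trans (iter_contract _ _ _)) // subr0.
  by rewrite ler_wpM2l ?exprn_ge0 // u_le.
have qM_small e : 0 < e -> exists K, forall k, (K <= k)%N -> q ^+ k * M <= e.
  move=> e_gt0.
  have M1 : 0 < M + 1 by rewrite ltr_wpDl // (le_trans (seminorm_ge0 sn _) (u_le 0%N)).
  have /cvgrPdist_lt /(_ (e / (M + 1))) [] : q ^+ k @[k --> \oo] --> 0.
  - by apply: cvg_expr; rewrite ger0_norm.
  - by rewrite divr_gt0.
  move=> K _ HK; exists K => k /HK /=.
  rewrite sub0r normrN ger0_norm ?exprn_ge0 // ltr_pdivlMr // => /ltW.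
  by have := exprn_ge0 k q_ge0; lra.
have [|l ul] := n_complete (u := u).
  move=> e e_gt0; have [K HK] := qM_small _ (divr_gt0 e_gt0 (ltr0n _ 2)).
  exists K => i j Ki Kj.
  have := u_cauchy K (i - K)%N; have := u_cauchy K (j - K)%N.
  rewrite !subnKC // => uj ui.
  have -> : u i - u j = (u i - u K) - (u j - u K) by rewrite opprB addrA subrK.
  by rewrite (le_trans (seminormB sn _ _)) //; have := HK K (leqnn K); lra.
have fl : f l - l = 0.
  apply/n_eq0/le_anti; rewrite (seminorm_ge0 sn) andbT.
  apply/ler_addgt0Pl => e e_gt0; rewrite addr0.
  have [K HK] := ul _ (divr_gt0 e_gt0 (ltr0n _ 2)).
  have := seminormD sn (f l - u K.+1) (u K.+1 - l); rewrite addrA subrK.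
  have := f_contract l (u K); rewrite -[f (u K)]/(u K.+1) (seminorm_distC sn l).
  have := HK K.+1 (leqnSn K); have := HK K (leqnn K).
  have := seminorm_ge0 sn (u K - l).
  by nra.
exists l; rewrite /= actE; have /(congr1 ( *:%R r)) := fl.
rewrite scaler0 scalerBr scalerA divff ?gt_eqF // scale1r => /eqP.
by rewrite addrAC subr_eq0 => /eqP.
Qed.

(** Spectral mapping by induction on the degree, splitting off a complex root of p. A real root is
    negative (spectral hypothesis) or exceeds r (Neumann); a non-real root contributes a real
    quadratic factor. *)
Lemma invertible_act X r p : 0 <= r -> (forall z, n (X z) <= r * n z) ->
  nonneg_spectrum n X -> (forall t, 0 <= t <= r -> p.[t] != 0) ->
  invertible_op n (act X p).
Proof.
move=> r_ge0 Xr [sp1 sp2].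
have [m] := ubnP (size p); elim: m p => // m IHm p lt_pm p_neq0.
have [/size1_polyC pE|size_p] := leqP (size p) 1.
  rewrite pE; apply: invertible_actC.
  by rewrite -horner_coef0 p_neq0 // lexx r_ge0.
have p_nz : p != 0 by rewrite -size_poly_gt0 (ltn_trans _ size_p).
have factor q : q %| p -> (1 < size q)%N -> invertible_op n (act X q) ->
    invertible_op n (act X p).
  move=> q_dvd_p size_q inv_q; rewrite -(divpK q_dvd_p).
  apply: invertible_actM => //; apply: IHm.
    rewrite size_divp; last first.
      by rewrite -size_poly_gt0 (ltn_trans _ size_q).
    rewrite -ltnS (leq_trans _ lt_pm) // ltnS ltn_subrL -(subnKC size_q) /=.
    by rewrite (ltn_trans _ size_p).
  move=> t /p_neq0; apply: contraNneq => qt0.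
  by rewrite -(divpK q_dvd_p) hornerM qt0 mul0r.
have [[al be] /= rootp] : exists z : R[i], root (map_poly (real_complex R) p) z.
  apply/closed_rootP; rewrite size_map_poly; by case: (size p) size_p => [|[|]].
have [be0|be_nz] := eqVneq be 0.
  have palE : p.[al] = 0.
    move: rootp; rewrite be0 /root -[_ +i* 0]/(real_complex R al) horner_map.
    by rewrite fmorph_eq0 => /eqP.
  apply: (factor ('X - al%:P)); rewrite ?size_XsubC // ?dvdp_XsubCl;
    first by apply/rootP.
  have [/sp1 //|al_ge0] := ltP al 0.
  apply: (@neumann _ r) => //; rewrite r_ge0 /= ltNge; apply/negP => al_le.
  by have /p_neq0 := introT andP (conj al_ge0 al_le); rewrite palE eqxx.
set q := ('X - al%:P) ^+ 2 + (be ^+ 2)%:P.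
have size_q : size q = 3%N.
  by rewrite /q size_polyDl size_exp_XsubC // size_polyC ltnS; case: (_ != 0).
apply: (factor q); rewrite ?size_q //; last exact: sp2.
have size_r : (size (p %% q)%R <= 2)%N.
  by rewrite -ltnS -size_q ltn_modp -size_poly_gt0 size_q.
(* The remainder modulo q has degree at most 1 and vanishes at the non-real root, so both of its
   real coefficients are 0. *)
set r1 := (p %% q)`_1; set r0 := (p %% q)`_0.
have modE : p %% q = r1 *: 'X + r0%:P.
  apply/polyP => -[|[|i]];
    rewrite coefD coefZ coefX coefC /= ?(mulr1, mulr0, add0r, addr0) //.
  by rewrite nth_default // (leq_trans size_r).
have : p = (p %/ q) * q + (r1 *: 'X + r0%:P) by rewrite -modE -divp_eq.
move=> /(congr1 (map_poly (real_complex R))) pE.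
suff [r1_eq0 r0_eq0] : r1 = 0 /\ r0 = 0.
  by apply/modp_eq0P; rewrite modE r1_eq0 r0_eq0 scale0r add0r.
move: rootp; rewrite pE /root /q -mul_polyC.
rewrite !(rmorphD, rmorphN, rmorphM, rmorphXn) /= !(map_polyX, map_polyC) !hornerE.
have z_root : (al +i* be - al%:C) * (al +i* be - al%:C) + be%:C * be%:C = 0.
  by simpc; congr (_ +i* _); ring.
rewrite z_root mulr0 /= add0r eq_complex /= => /andP[/eqP re /eqP im].
have r1_eq0 : r1 = 0.
  by apply/eqP; have/eqP := im; rewrite mul0r !addr0 mulf_eq0 (negPf be_nz) orbF.
by split=> //; move: re; rewrite r1_eq0 !mul0r subr0 add0r.
Qed.

End Invertibility.

(** * Powers in a Jordan triple *)

Record jordan_triple (R : realType) (V : lmodType R) (t : V -> V -> V -> V) :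
    Prop := JordanTriple {
  triple_sym : forall x y z, t x y z = t z y x ;
  triple_linearl : forall k x x' y z, t (k *: x + x') y z = k *: t x y z + t x' y z ;
  triple_linearm : forall k x y y' z, t x (k *: y + y') z = k *: t x y z + t x y' z ;
  triple_jordan : forall a b x y z,
    t a b (t x y z) - t x y (t a b z) = t (t a b x) y z - t x (t b a y) z }.

(** Carrying [jt] as an argument lets the linear structure of L(x, y) be inferred from the term
    itself. *)
Definition triple_op (R : realType) (V : lmodType R) (t : V -> V -> V -> V)
  (jt : jordan_triple t) (x y : V) : V -> V := t x y.

Lemma triple_op_linear (R : realType) (V : lmodType R) (t : V -> V -> V -> V)
  (jt : jordan_triple t) x y : linear (triple_op jt x y).
Proof.
by move=> k z z'; rewrite /triple_op !(triple_sym jt x y) (triple_linearl jt).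
Qed.

HB.instance Definition _ (R : realType) (V : lmodType R) (t : V -> V -> V -> V)
    (jt : jordan_triple t) x y :=
  GRing.isLinear.Build R V V _ (triple_op jt x y) (triple_op_linear jt x y).

Section TriplePowers.
Context {R : realType} {V : lmodType R} (t : V -> V -> V -> V).
Hypothesis jt : jordan_triple t.
Variable a : V.

Let D : {linear V -> V} := triple_op jt a a.
Let pow i : V := iter i D a.

Let powS i : pow i.+1 = t a a (pow i).
Proof. by []. Qed.

Let box_shift i j z :
  t a a (t (pow i) (pow j) z) - t (pow i) (pow j) (t a a z) =
  t (pow i.+1) (pow j) z - t (pow i) (pow j.+1) z.
Proof. by rewrite (triple_jordan jt). Qed.

(* The commutator Z of D and L(pow n, a) is the difference of consecutive
   L(pow i, pow j), i + j = n + 1; the Jordan identity also expresses - Z as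
   the telescoping sum of all n + 1 of these. Hence (n + 2) Z = 0. *)
Let box_comm n :
  (forall i j z, (i + j = n)%N -> t (pow i) (pow j) z = t (pow n) a z) ->
  forall z, t a a (t (pow n) a z) = t (pow n) a (t a a z).
Proof.
move=> box_n z; pose Z := t a a (t (pow n) a z) - t (pow n) a (t a a z).
have step i j : (i + j = n)%N ->
    t (pow i.+1) (pow j) z = t (pow i) (pow j.+1) z + Z.
  by move=> ij; rewrite /Z -!(box_n i j) // box_shift addrC subrK.
have sum_steps i : (i <= n.+1)%N ->
    t (pow i) (pow (n.+1 - i)%N) z = t a (pow n.+1) z + Z *+ i.
  elim: i => [_|i IHi lt_in]; first by rewrite subn0 addr0.
  rewrite subSS step ?subnKC // -subSn // IHi ?mulrSr ?addrA //.
  exact: ltnW.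
have := triple_jordan jt (pow n) a a a z.
have pow_sym : t a (pow n) a = t (pow n) a a by rewrite -(box_n 0 n).
rewrite pow_sym (triple_sym jt (pow n) a a) -powS.
have := sum_steps n.+1 (leqnn _); rewrite subnn -[pow 0]/a => ->.
rewrite -opprB -/Z [t a _ z + _]addrC addrK => Z_eq.
apply/eqP; rewrite -subr_eq0 -/Z.
have : Z *+ n.+2 = 0 by rewrite mulrS -Z_eq subrr.
by move/eqP; rewrite -(scaler_nat _ Z) scaler_eq0 pnatr_eq0.
Qed.

(** Once D commutes with L(pow n, a), the Jordan identity in [box_shift] moves one power from the
    first slot to the second without changing the operator. *)
Let box_pow n i j z : (i + j = n)%N -> t (pow i) (pow j) z = t (pow n) a z.
Proof.
elim: n i j z => [|n IHn] i j z; first by move/eqP;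
  rewrite addn_eq0 => /andP[/eqP-> /eqP->].
have step i' j' : (i' + j' = n)%N -> t (pow i'.+1) (pow j') z = t (pow i') (pow
  j'.+1) z.
  move=> ij; apply/eqP; rewrite -subr_eq0 -box_shift !(IHn i' j') //.
  by rewrite (box_comm IHn) subrr.
elim: j i => [|j IHj] i; first by rewrite addn0 => ->.
by rewrite addnS => -[ij]; rewrite -step // IHj // addSn ij.
Qed.

(** Power associativity. [iter i D a] is the odd power a^(2i+1), and (2i+1) + (2j+1) + (2k+1) =
    2(i+j+k+1) + 1, whence the successor. *)
Lemma triple_pow i j k :
  t (iter i D a) (iter j D a) (iter k D a) = iter (i + j + k).+1 D a.
Proof.
rewrite -/(pow i) -/(pow j) (@box_pow (i + j)) //.
have -> : iter (i + j + k).+1 D a = iter k D (pow (i + j).+1).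
  by rewrite /pow -iterD addnS addnC.
elim: k => [|k IHk]; first by rewrite (triple_sym jt).
rewrite !iterS -IHk -[D (iter k D a)]/(t a a (iter k D a)).
by rewrite -(box_comm (fun i j z => @box_pow _ i j z)).
Qed.

Lemma poly_monomial_ind (P : {poly R} -> Prop) :
  (forall k p q, P p -> P q -> P (k *: p + q)) -> (forall i, P 'X^i) ->
  forall p, P p.
Proof.
move=> Plin PX p; have P0 : P 0.
  by have := Plin (- 1) _ _ (PX 0%N) (PX 0%N); rewrite scaleN1r addNr.
rewrite -[p]coefK poly_def; apply: (big_ind P) => // [q q' Pq Pq'|i _].
  by rewrite -[q]scale1r; apply: Plin.
by rewrite -[_ *: _]addr0; apply: Plin.
Qed.

(** The extra 'X is the square in x p(x^2) * x q(x^2) * x r(x^2) = x * x^2 (p q r)(x^2). *)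
Lemma triple_act p q r :
  t (act D p a) (act D q a) (act D r a) = act D (p * q * r * 'X) a.
Proof.
elim/poly_monomial_ind: p => [k p p' IH IH'|i].
  rewrite actD actZ (triple_linearl jt) IH IH' -actZ -actD.
  by rewrite !mulrDl -!scalerAl.
elim/poly_monomial_ind: q => [k q q' IH IH'|j].
  rewrite actD actZ (triple_linearm jt) IH IH' -actZ -actD.
  by rewrite mulrDr !mulrDl -scalerAr -!scalerAl.
elim/poly_monomial_ind: r => [k r r' IH IH'|l].
  rewrite !(triple_sym jt (act D 'X^i a)) in IH IH' *.
  rewrite actD actZ (triple_linearl jt) IH IH' -actZ -actD.
  by rewrite mulrDr !mulrDl -scalerAr -!scalerAl.
by rewrite -!exprD -exprSr !act_Xn triple_pow.
Qed.

End TriplePowers.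

(** * The norm of a polynomial in one element *)

Record positive_triple (R : realType) (V : lmodType R) (t : V -> V -> V -> V)
    (n : V -> R) : Prop := PositiveTriple {
  pt_triple : jordan_triple t ;
  pt_norm : seminorm n ;
  pt_eq0 : forall x, n x = 0 -> x = 0 ;
  pt_complete : complete_norm n ;
  pt_bounded : exists N, forall x y z, n (t x y z) <= N * n x * n y * n z ;
  pt_cube : forall x, n (t x x x) = n x ^+ 3 ;
  pt_spectrum : forall x, nonneg_spectrum n (triple_op pt_triple x x) }.

Lemma expr3_unbounded (R : realType) (y C : R) :
  0 <= y -> (forall j, y ^+ (3 ^ j) <= C) -> y <= 1.
Proof.
move=> y_ge0 yC; rewrite leNgt; apply/negP => y_gt1.
have bernoulli m : 1 + m%:R * (y - 1) <= y ^+ m.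
  elim: m => [|m IHm]; first by rewrite mul0r addr0.
  have : 0 <= m%:R * (y - 1) ^+ 2 by rewrite mulr_ge0 ?sqr_ge0.
  by have := ler_wpM2l y_ge0 IHm; rewrite [y ^+ m.+1]exprS -natr1; nra.
have d_gt0 : 0 < y - 1 by lra.
pose j := Num.bound (C / (y - 1)).
have Cj : C < j%:R * (y - 1).
  rewrite -ltr_pdivrMr // /j archi_boundP // divr_ge0 ?ltW //.
  by rewrite (lt_le_trans _ (yC 0%N)) ?expr1 // (lt_trans ltr01).
have : j%:R <= (3 ^ j)%:R :> R by rewrite ler_nat ltnW // ltn_expl.
have := yC j; have := bernoulli (3 ^ j)%N.
by nra.
Qed.

Lemma act_bounded (R : realType) (V : lmodType R) (v : V -> R) :
  seminorm v -> forall (X : {linear V -> V}) (p : {poly R}),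
  op_bounded v X -> op_bounded v (act X p).
Proof.
move=> sv X p /op_bounded_pos [//|B B_gt0 XB].
elim/(@poly_monomial_ind R): p => [k p q [C pC] [C' qC']|i].
  exists (`|k| * C + C') => z; rewrite actD actZ (le_trans (seminormD sv _ _)) //.
  by rewrite mulrDl lerD // (seminormZ sv) -mulrA ler_wpM2l.
exists (B ^+ i) => z; rewrite act_Xn.
elim: i => [|i IHi]; first by rewrite mul1r.
by rewrite (le_trans (XB _)) // exprS -mulrA ler_wpM2l // ltW.
Qed.

Lemma eq_invertible_op (R : realType) (V : lmodType R) (v : V -> R) (S S' : V -> V) :
  S =1 S' -> invertible_op v S -> invertible_op v S'.
Proof.
move=> SS' [U [Ub SU US]]; exists U; split=> // z; first by rewrite -SS' SU.
by rewrite -SS' US.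
Qed.

(** The value is |1 - l y|^2 for l = al + i be, and al y <= 1/2 keeps the real part of 1 - l y at
    least 1/2. This is the origin of the threshold 1/4 below. *)
Lemma quadp_ge (R : realType) (al be y : R) : `|al| <= 2 -> `|y| <= 4^-1 ->
  4^-1 <= 1 - 2 * al * y + (al ^+ 2 + be ^+ 2) * y ^+ 2.
Proof.
move=> al2 y4; have -> : 1 - 2 * al * y + (al ^+ 2 + be ^+ 2) * y ^+ 2 =
  (1 - al * y) ^+ 2 + (be * y) ^+ 2 by ring.
have : `|al * y| <= 2 * 4^-1 by rewrite normrM ler_pM.
rewrite ler_norml => /andP[_ aly]; have := sqr_ge0 (be * y).
by nra.
Qed.

Section PolynomialNorm.
Context {R : realType} {V : lmodType R} (t : V -> V -> V -> V) (n : V -> R).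
Hypothesis pt : positive_triple t n.
Variables (a : V) (r : R).

Let D : {linear V -> V} := triple_op (pt_triple pt) a a.
Let sn := pt_norm pt.

(** The cube identity iterated j times; the exponent is e = (3^j - 1)/2. Its upper bound limits the
    growth of D^e a, its lower bound later forces (3/4)^e to be small. *)
Lemma odd_powers_norm p j : exists2 e, (j <= e < 3 ^ j)%N &
  n (act D (p ^+ (3 ^ j) * 'X^e) a) = n (act D p a) ^+ (3 ^ j).
Proof.
elim: j => [|j [e /andP[le_je lt_e] IHe]]; first by exists 0%N; rewrite // mulr1.
exists (3 * e).+1; first by rewrite expnS; lia.
rewrite expnSr !exprM -IHe -(pt_cube pt) (triple_act (pt_triple pt) a).
have -> : 'X^((3 * e).+1) = 'X^e ^+ 3 * 'X :> {poly R} by rewrite exprSr mulnC exprM.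
by congr (n (act D _ a)); ring.
Qed.

Hypothesis a1 : n a <= 1.
Hypothesis r_ge1 : 1 <= r.
Hypothesis Dr : forall z, n (t a a z) <= r * n z.

Let r_ge0 : 0 <= r. Proof. by apply: le_trans r_ge1. Qed.

(** Where |p| <= 1/4 the quadratics in p have no zero, so spectral mapping inverts them and the
    spectral radius formula applies to p(D). *)
Lemma power_bounded_act p : (forall s, 0 <= s <= r -> `|p.[s]| <= 4^-1) ->
  exists C, forall m z, n (act D (p ^+ m) z) <= C * n z.
Proof.
move=> p_small.
have [||C HC] := power_bounded sn (X := act D p).
- by apply: (act_bounded sn); exists r.
- move=> al be al2 be2.
  apply: (@eq_invertible_op _ _ _ (act D (quadp al be p))).
    move=> z; rewrite act_comp; congr (act D _ z).
    by rewrite /quadp !(rmorphD, rmorphN, rmorphM, rmorphXn) /= rmorph1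
      !comp_polyC comp_polyX.
  refine (invertible_act sn (pt_eq0 pt) (pt_complete pt) (X := D) r_ge0 Dr
    (pt_spectrum pt a) _).
  move=> s s_in; have -> : (quadp al be p).[s] =
      1 - 2 * al * p.[s] + (al ^+ 2 + be ^+ 2) * p.[s] ^+ 2.
    by rewrite /quadp !hornerE; ring.
  by rewrite gt_eqF // (lt_le_trans _ (quadp_ge _ al2 (p_small _ s_in))).
exists C => m z; rewrite -(comp_Xn_poly p m) -act_comp; exact: HC.
Qed.

(** With y the norm of p(D) a, power-boundedness gives y^(3^j) <= C r^e <= C r^(3^j) for every j. So
    (y / r)^(3^j) stays bounded, and the unknown C drops out. *)
Lemma poly_norm_le_quarter p : (forall s, 0 <= s <= r -> `|p.[s]| <= 4^-1) ->
  n (act D p a) <= r.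
Proof.
move=> /power_bounded_act [C0 HC0].
have [C C_ge0 HC] : exists2 C, 0 <= C & forall m z, n (act D (p ^+ m) z) <= C * n z.
  exists (Num.max C0 0); first by rewrite le_max lexx orbT.
  move=> m z; rewrite (le_trans (HC0 m z)) // ler_wpM2r ?(seminorm_ge0 sn) //.
  by rewrite le_max lexx.
have r_gt0 : 0 < r by apply: lt_le_trans r_ge1.
rewrite -[r]mul1r -ler_pdivrMr //; apply: (@expr3_unbounded _ _ C).
  by rewrite divr_ge0 ?(seminorm_ge0 sn).
move=> j; have [e /andP[_ lt_e] pE] := odd_powers_norm p j.
rewrite expr_div_n ler_pdivrMr ?exprn_gt0 // -pE actM.
rewrite (le_trans (HC _ _)) // ler_wpM2l // act_Xn.
have pow_le i : n (iter i D a) <= r ^+ i.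
  elim: i => //= i IHi; rewrite (le_trans (Dr _)) // exprS ler_wpM2l //.
by rewrite (le_trans (pow_le e)) // ler_weXn2l // ltnW.
Qed.

Lemma poly_norm_le p B : 0 < B -> (forall s, 0 <= s <= r -> `|p.[s]| <= B) ->
  n (act D p a) <= 4 * r * B.
Proof.
move=> B_gt0 pB; have := @poly_norm_le_quarter ((4 * B)^-1 *: p).
rewrite actZ (seminormZ sn) gtr0_norm ?invr_gt0 ?mulr_gt0 //.
rewrite ler_pdivrMl ?mulr_gt0 // => H; rewrite (le_trans (H _)); first by lra.
  move=> s s_in; rewrite hornerZ normrM gtr0_norm ?invr_gt0 ?mulr_gt0 //.
  by rewrite ler_pdivrMl ?mulr_gt0 //; have := pB s s_in; lra.
by rewrite mulrAC.
Qed.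

End PolynomialNorm.

(** * Uniform limits of polynomials *)

Section UniformLimits.
Context {R : realType} (r : R).
Hypothesis r_ge0 : 0 <= r.
Implicit Types (f g : R -> R) (p q : {poly R}).

Definition close_on f g (e : R) : Prop :=
  forall s, 0 <= s <= r -> `|f s - g s| <= e.

Definition polylim f : Prop :=
  forall e, 0 < e -> exists p, close_on f (horner p) e.

Lemma polylim_poly p : polylim (horner p).
Proof. by move=> e e_gt0; exists p => s _; rewrite subrr normr0 ltW. Qed.

Lemma polylim_cst c : polylim (fun=> c).
Proof. by move=> e e_gt0; exists c%:P => s _; rewrite hornerC subrr normr0 ltW. Qed.

Lemma polylim_id : polylim id.
Proof. by move=> e e_gt0; exists 'X => s _; rewrite hornerX subrr normr0 ltW. Qed.

Lemma polylim_lim f :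
  (forall e, 0 < e -> exists2 g, polylim g & close_on f g e) -> polylim f.
Proof.
move=> lim e e_gt0; have e2 : 0 < e / 2 by rewrite divr_gt0.
have [g /(_ _ e2) [p gp] fg] := lim _ e2; exists p => s s_in.
rewrite (splitr e) -[_ - _](subrKA (g s)).
by rewrite (le_trans (ler_normD _ _)) // lerD ?fg ?gp.
Qed.

Lemma polylim_bounded f : polylim f ->
  exists2 B, 0 < B & forall s, 0 <= s <= r -> `|f s| <= B.
Proof.
move=> /(_ 1 ltr01) [p fp].
have [B B_gt0 pB] : exists2 B, 0 < B & forall s, 0 <= s <= r -> `|p.[s]| <= B.
  elim/poly_ind: p {fp} => [|p c [B B_gt0 pB]].
    by exists 1 => // s _; rewrite horner0 normr0.
  exists (B * r + `|c| + 1); first by rewrite ltr_wpDl // addr_ge0 // mulr_ge0 // ltW.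
  move=> s s_in; rewrite hornerMXaddC (le_trans (ler_normD _ _)) //.
  have : `|p.[s] * s| <= B * r.
    case/andP: (s_in) => s_ge0 s_le; rewrite normrM ler_pM ?pB //.
    by rewrite ger0_norm.
  by lra.
exists (1 + B); first by rewrite addr_gt0.
move=> s s_in; rewrite -(subrK p.[s] (f s)) (le_trans (ler_normD _ _)) //.
by rewrite lerD ?fp ?pB.
Qed.

Lemma polylimD f g : polylim f -> polylim g -> polylim (fun s => f s + g s).
Proof.
move=> fl gl e e_gt0; have e2 : 0 < e / 2 by rewrite divr_gt0.
have [p fp] := fl _ e2; have [q gq] := gl _ e2; exists (p + q) => s s_in.
rewrite hornerD opprD addrACA (splitr e) (le_trans (ler_normD _ _)) //.
by rewrite lerD ?fp ?gq.
Qed.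

Lemma polylimM f g : polylim f -> polylim g -> polylim (fun s => f s * g s).
Proof.
move=> fl gl e e_gt0.
have [A A_gt0 fA] := polylim_bounded fl.
have e1 : 0 < e / (2 * A) by rewrite divr_gt0 ?mulr_gt0.
have [q gq] := gl _ e1.
have [B B_gt0 qB] := polylim_bounded (polylim_poly q).
have e2 : 0 < e / (2 * B) by rewrite divr_gt0 ?mulr_gt0.
have [p fp] := fl _ e2; exists (p * q) => s s_in.
have -> : f s * g s - (p * q).[s] = f s * (g s - q.[s]) + (f s - p.[s]) * q.[s].
  by rewrite hornerM; ring.
rewrite (le_trans (ler_normD _ _)) // !normrM.
have -> : e = A * (e / (2 * A)) + (e / (2 * B)) * B.
  by field; rewrite !gt_eqF.
by rewrite lerD // ler_pM ?fA ?gq ?fp ?qB.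
Qed.

Lemma polylimZ k f : polylim f -> polylim (fun s => k * f s).
Proof.
move=> fl e e_gt0; have k_gt0 : 0 < `|k| + 1 by rewrite ltr_wpDl.
have [p fp] := fl _ (divr_gt0 e_gt0 k_gt0); exists (k *: p) => s s_in.
rewrite hornerZ -mulrBr normrM (le_trans (ler_wpM2l _ (fp s s_in))) //.
by rewrite mulrCA ler_piMr ?(ltW e_gt0) // ler_pdivrMr // mul1r lerDl.
Qed.

Lemma polylimB f g : polylim f -> polylim g -> polylim (fun s => f s - g s).
Proof.
move=> fl gl; have := polylimD fl (polylimZ (-1) gl).
by under eq_fun do rewrite mulN1r.
Qed.

Lemma polylimX f k : polylim f -> polylim (fun s => f s ^+ k).
Proof.
move=> fl; elim: k => [|k IHk]; first exact: polylim_cst.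
by under eq_fun do rewrite exprS; apply: polylimM.
Qed.

Lemma geometric_small (q C e : R) : 0 <= q < 1 -> 0 <= C -> 0 < e ->
  exists k, C * q ^+ k <= e.
Proof.
move=> /andP[q_ge0 q_lt1] C_ge0 e_gt0.
have /cvgrPdist_lt /(_ (e / (C + 1))) [] : q ^+ k @[k --> \oo] --> 0.
- by apply: cvg_expr; rewrite ger0_norm.
- by rewrite divr_gt0 // ltr_wpDl.
move=> k _ /(_ k (leqnn k)) /=.
rewrite sub0r normrN ger0_norm ?exprn_ge0 // ltr_pdivlMr ?ltr_wpDl // => /ltW.
by exists k; have := exprn_ge0 k q_ge0; lra.
Qed.

(** With c <= f <= K, each step of v := v + K^-1 (1 - f v) multiplies the error 1/f - v by 1 - f/K,
    which is at most 1 - c/K. *)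
Lemma polylimV f c : 0 < c -> (forall s, 0 <= s <= r -> c <= f s) ->
  polylim f -> polylim (fun s => (f s)^-1).
Proof.
move=> c_gt0 fc fl; have [K K_gt0 fK] := polylim_bounded fl.
pose v := fix v k : R -> R := if k is k'.+1
  then fun s => v k' s + K^-1 * (1 - f s * v k' s) else fun=> 0.
have v_lim k : polylim (v k).
  elim: k => [|k IHk] /=; first exact: polylim_cst.
  apply/polylimD/polylimZ/polylimB; [exact: IHk|exact: polylim_cst|].
  exact: polylimM.
have c_le s : 0 <= s <= r -> c <= f s <= K.
  by move=> s_in; rewrite fc // (le_trans (ler_norm _)) // fK.
apply: polylim_lim => e e_gt0.
have [cK|cK] := ltP K c.
  exists (v 0%N) => // s s_in; have := c_le s s_in; lra.
have [k Hk] : exists k, c^-1 * (1 - c / K) ^+ k <= e.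
  apply: geometric_small; rewrite ?invr_ge0 ?(ltW c_gt0) //.
  by rewrite subr_ge0 ler_pdivrMr // mul1r cK ltrBlDr ltrDl divr_gt0.
exists (v k) => // s /c_le /andP[cs sK]; apply: le_trans Hk.
have fs_gt0 : 0 < f s by apply: lt_le_trans cs.
have f_inv : (f s)^-1 <= c^-1 by rewrite lef_pV2.
elim: k => [|k IHk] /=; first by rewrite subr0 mulr1 ger0_norm // invr_ge0 ltW.
have -> : (f s)^-1 - (v k s + K^-1 * (1 - f s * v k s)) =
    ((f s)^-1 - v k s) * (1 - f s / K).
  by field; rewrite !gt_eqF.
have fK0 : 0 <= 1 - f s / K by rewrite subr_ge0 ler_pdivrMr // mul1r.
rewrite normrM exprSr mulrA ler_pM // ger0_norm //.
by rewrite lerB // ler_wpM2r // invr_ge0 ltW.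
Qed.

(** The classical iteration u := u + (y^2 - u^2)/2 from 0 increases to y = |f|/B, with error at most
    2/(k+2) after k steps, uniformly in y in [0, 1]. *)
Lemma polylim_norm f : polylim f -> polylim (fun s => `|f s|).
Proof.
move=> fl; have [B B_gt0 fB] := polylim_bounded fl.
pose u := fix u k : R -> R := if k is k'.+1
  then fun s => u k' s + 2^-1 * ((B^-1 * f s) ^+ 2 - u k' s ^+ 2) else fun=> 0.
have u_lim k : polylim (u k).
  elim: k => [|k IHk] /=; first exact: polylim_cst.
  apply: polylimD => //; apply/polylimZ/polylimB; last exact: polylimX.
  exact/polylimX/polylimZ.
apply: polylim_lim => e e_gt0.
pose k := Num.bound (2 * B / e).
exists (fun s => B * u k s); first exact: polylimZ.
move=> s s_in; pose y := `|B^-1 * f s|.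
have y_le : 0 <= y <= 1.
  rewrite normr_ge0 /y normrM gtr0_norm ?invr_gt0 //.
  by rewrite ler_pdivrMl // mulr1 fB.
have yE : `|f s| = B * y by rewrite /y normrM gtr0_norm ?invr_gt0 // mulrA divff
  ?mul1r ?gt_eqF.
rewrite yE -mulrBr normrM gtr0_norm //.
have [y0 y1] := andP y_le.
have u_inv j : [/\ 0 <= u j s, u j s <= y & (y - u j s) * (j%:R + 2) <= 2].
  elim: j => [|j [u0 uy IHj]] /=; first by rewrite add0r; split; lra.
  have fy : (B^-1 * f s) ^+ 2 = y ^+ 2 by rewrite /y real_normK ?num_real.
  rewrite fy -natr1; have := ler0n R j; set x := u j s in u0 uy IHj *.
  move=> j_ge0.
  have gap : 0 <= (2 - (y - x) * (j%:R + 2)) * (1 - (y - x) / 2).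
    by apply: mulr_ge0; lra.
  have diff : 0 <= (y - x) * (1 - (y + x) / 2) by apply: mulr_ge0; lra.
  have sq : 0 <= (y - x) * x * (j%:R + 1 + 2) by apply: mulr_ge0; [apply: mulr_ge0;
    lra|lra].
  have : 0 <= (y - x) * (y + x) by apply: mulr_ge0; lra.
  by have := sqr_ge0 (y - x); rewrite -[1 + 1]/(2 : R) !expr2; split; lra.
have [u_ge0 u_le uk] := u_inv k; rewrite ger0_norm ?subr_ge0 //.
have k_gt : 2 * B < k%:R * e.
  by rewrite -ltr_pdivrMr // archi_boundP // divr_ge0 ?mulr_ge0 // ltW.
have k2 : 0 < k%:R + 2 :> R by rewrite ltr_wpDl.
rewrite -(ler_pM2r k2) -mulrA.
apply: (@le_trans _ _ (B * 2)); first by rewrite ler_wpM2l // ltW.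
by rewrite mulrC mulrDr; lra.
Qed.

Lemma polylim_max f g : polylim f -> polylim g ->
  polylim (fun s => Num.max (f s) (g s)).
Proof.
move=> fl gl; under eq_fun do rewrite maxr_absE mulrC.
by apply/polylimZ/polylimD; [apply: polylimD|apply/polylim_norm/polylimB].
Qed.

Lemma polylim_min f g : polylim f -> polylim g ->
  polylim (fun s => Num.min (f s) (g s)).
Proof.
move=> fl gl; under eq_fun do rewrite minr_absE mulrC.
by apply/polylimZ/polylimB; [apply: polylimD|apply/polylim_norm/polylimB].
Qed.

End UniformLimits.

(** * The module of uniform limits and its multiplication operators *)

Definition polylim_pred (R : realType) (r : R) : {pred R -> R} :=
  fun f => `[< polylim r f >].

Lemma polylim_pred_submod (R : realType) (r : R) :
  submod_closed (polylim_pred r).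
Proof.
split=> [|k f g /asboolP fl /asboolP gl]; apply/asboolP.
  exact: polylim_cst.
exact/polylimD/gl/polylimZ.
Qed.

HB.instance Definition _ (R : realType) (r : R) :=
  GRing.isSubmodClosed.Build R (R -> R) (polylim_pred r) (polylim_pred_submod r).

(** Elements are functions on the whole line and are equal only if they agree there, so the
    identities between multiplication operators below are checked for every s, not only on
    [0, r]. *)
Record limfun (R : realType) (r : R) := Limfun {
  limfun_val :> R -> R ;
  limfun_mem : limfun_val \in polylim_pred r }.

HB.instance Definition _ (R : realType) (r : R) :=
  [isSub for @limfun_val R r].
HB.instance Definition _ (R : realType) (r : R) := [Choice of limfun r by <:].
HB.instance Definition _ (R : realType) (r : R) :=
  [SubChoice_isSubLmodule of limfun r by <:].

Lemma limfunP (R : realType) (r : R) (f : limfun r) : polylim r f.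
Proof. by have /asboolP := limfun_mem f. Qed.

Definition mk_limfun (R : realType) (r : R) (f : R -> R) (fl : polylim r f) :
  limfun r := Limfun (asboolT fl).

Lemma limfun_linear (R : realType) (r k : R) (f g : limfun r) s :
  (k *: f + g) s = k * f s + g s.
Proof. by []. Qed.

Definition limfun_mul (R : realType) (r : R) (r_ge0 : 0 <= r) (g f : limfun r) :
  limfun r := mk_limfun (polylimM r_ge0 (limfunP g) (limfunP f)).

Lemma limfun_mul_linear (R : realType) (r : R) (r_ge0 : 0 <= r) (g : limfun r) :
  linear (limfun_mul r_ge0 g).
Proof.
move=> k f f'; apply/val_inj/funext => s.
rewrite -[LHS]/(g s * (k * f s + f' s)) -[RHS]/(k * (g s * f s) + g s * f' s).
by rewrite mulrDr mulrCA.
Qed.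

HB.instance Definition _ (R : realType) (r : R) (r_ge0 : 0 <= r) (g : limfun r) :=
  GRing.isLinear.Build R (limfun r) (limfun r) _ (limfun_mul r_ge0 g)
    (limfun_mul_linear r_ge0 g).

Lemma act_limfun_mul (R : realType) (r : R) (r_ge0 : 0 <= r) (g f : limfun r) p s :
  act (limfun_mul r_ge0 g) p f s = p.[g s] * f s.
Proof.
elim/poly_ind: p f => [|p c IHp] f; first by rewrite act0 horner0 mul0r.
rewrite actD actMX actC addrC limfun_linear IHp hornerMXaddC /=.
by rewrite addrC mulrDl mulrA.
Qed.

(** * Functional calculus *)

Section FunctionalCalculus.
Context {R : realType} {V : lmodType R} (t : V -> V -> V -> V) (n : V -> R).
Hypothesis pt : positive_triple t n.
Variables (a : V) (r : R).

Let D : {linear V -> V} := triple_op (pt_triple pt) a a.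
Let sn := pt_norm pt.

Hypothesis a1 : n a <= 1.
Hypothesis r_ge1 : 1 <= r.
Hypothesis Dr : forall z, n (t a a z) <= r * n z.

Let r_gt0 : 0 < r. Proof. by apply: lt_le_trans r_ge1. Qed.
Let r_ge0 : 0 <= r. Proof. exact: ltW. Qed.

(* z is x f(x^2) at x = a, so that 1 yields a and D acts as the variable. *)
Definition calc (f : R -> R) (z : V) : Prop := forall e, 0 < e ->
  exists p, close_on r f (horner p) e /\ n (act D p a - z) <= e.

Lemma calc_poly p : calc (horner p) (act D p a).
Proof.
move=> e e_gt0; exists p; split; first by move=> s _; rewrite subrr normr0 ltW.
by rewrite subrr (seminorm0 sn) ltW.
Qed.

Lemma calc_lim f z : (forall e, 0 < e -> exists g y,
  [/\ calc g y, close_on r f g e & n (y - z) <= e]) -> calc f z.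
Proof.
move=> lim e e_gt0; have e2 : 0 < e / 2 by rewrite divr_gt0.
have [g [y [gy fg yz]]] := lim _ e2; have [p [gp py]] := gy _ e2.
exists p; split=> [s s_in|].
  rewrite (splitr e) -[_ - _](subrKA (g s)) (le_trans (ler_normD _ _)) //.
  by rewrite lerD ?fg ?gp.
rewrite (splitr e) -[_ - _](subrKA y) (le_trans (seminormD sn _ _)) //.
by rewrite lerD.
Qed.

Lemma calc_bound f z B : 0 < B -> (forall s, 0 <= s <= r -> `|f s| <= B) ->
  calc f z -> n z <= 4 * r * B.
Proof.
move=> B_gt0 fB fz; apply/ler_addgt0Pl => e e_gt0.
have d_gt0 : 0 < e / (4 * r + 1) by rewrite divr_gt0 // addr_gt0 // mulr_gt0.
have [p [fp pz]] := fz _ d_gt0; set d := e / _ in d_gt0 fp pz.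
have pB : n (act D p a) <= 4 * r * (B + d).
  apply: (poly_norm_le pt a1 r_ge1 Dr); first exact: addr_gt0.
  move=> s s_in; rewrite -(subrK (f s) p.[s]) (le_trans (ler_normD _ _)) //.
  by rewrite [B + d]addrC lerD ?fB // distrC fp.
have dE : e = (4 * r + 1) * d by rewrite /d mulrC divfK // gt_eqF // addr_gt0 //
  mulr_gt0.
have := seminorm_sub sn z (act D p a); rewrite (seminorm_distC sn z).
by rewrite dE; lra.
Qed.

Lemma calc_linear k f g y z : calc f y -> calc g z ->
  calc (fun s => k * f s + g s) (k *: y + z).
Proof.
move=> fy gz e e_gt0; have k_gt0 : 0 < `|k| + 1 by rewrite ltr_wpDl.
have d_gt0 : 0 < e / (`|k| + 1) by rewrite divr_gt0.
have dE : e = (`|k| + 1) * (e / (`|k| + 1)) by rewrite mulrC divfK // gt_eqF.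
set d := e / _ in d_gt0 dE.
have [p [fp py]] := fy _ d_gt0; have [q [gq qz]] := gz _ d_gt0.
exists (k *: p + q); split=> [s s_in|].
  rewrite hornerD hornerZ opprD addrACA -mulrBr (le_trans (ler_normD _ _)) //.
  rewrite normrM dE mulrDl mul1r lerD ?gq // ler_wpM2l // fp //.
rewrite actD actZ opprD addrACA -scalerBr (le_trans (seminormD sn _ _)) //.
by rewrite (seminormZ sn) dE mulrDl mul1r lerD // ler_wpM2l.
Qed.

Lemma calc_eq f g z : (forall s, 0 <= s <= r -> f s = g s) -> calc f z -> calc g z.
Proof.
move=> fg fz e e_gt0; have [p [fp pz]] := fz e e_gt0; exists p; split=> // s s_in.
by rewrite -fg // fp.
Qed.

Lemma calc_unique f y z : calc f y -> calc f z -> y = z.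
Proof.
move=> fy fz; have := calc_linear (-1) fy fz.
rewrite scaleN1r addrC => fyz; apply/esym/eqP; rewrite -subr_eq0;
  apply/eqP/(pt_eq0 pt)/le_anti.
rewrite (seminorm_ge0 sn) andbT; apply/ler_addgt0Pl => e e_gt0; rewrite addr0.
have -> : e = 4 * r * (e / (4 * r)) by rewrite mulrC divfK // gt_eqF // mulr_gt0.
apply: calc_bound fyz; first by rewrite divr_gt0 // mulr_gt0.
by move=> s _; rewrite mulN1r addNr normr0 divr_ge0 ?mulr_ge0 // ltW.
Qed.

Lemma calc_exists f : polylim r f -> exists z, calc f z.
Proof.
move=> fl.
have /choice [p fp] : forall k, exists p, close_on r f (horner p) k.+1%:R^-1.
  by move=> k; apply: fl; rewrite invr_gt0.
have inv_small (e : R) : 0 < e -> exists K, forall k, (K <= k)%N -> k.+1%:R^-1 <= e.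
  move=> e_gt0; exists (Num.bound e^-1) => k le_k.
  rewrite -[leRHS]invrK lef_pV2 ?posrE ?invr_gt0 //.
  rewrite (le_trans (ltW (archi_boundP _))) ?invr_ge0 ?(ltW e_gt0) //.
  by rewrite ler_nat (leq_trans le_k).
have p_close i j e : 0 < e -> i.+1%:R^-1 <= e -> j.+1%:R^-1 <= e ->
    n (act D (p i) a - act D (p j) a) <= 4 * r * (2 * e).
  move=> e_gt0 ie je; rewrite -actB; apply: (poly_norm_le pt a1 r_ge1 Dr).
    by rewrite mulr_gt0.
  move=> s s_in; rewrite hornerD hornerN -[_ - _](subrKA (f s)).
  rewrite (le_trans (ler_normD _ _)) // [`|_ - f s|]distrC.
  by rewrite mulr_natl mulr2n lerD // (le_trans (fp _ s s_in)).
have [|z pz] := pt_complete pt (u := fun k => act D (p k) a).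
  move=> e e_gt0; have d_gt0 : 0 < e / (4 * r * 2) by rewrite divr_gt0 ?mulr_gt0.
  have [K HK] := inv_small _ d_gt0; exists K => i j Ki Kj.
  rewrite (le_trans (p_close i j _ d_gt0 (HK i Ki) (HK j Kj))) //.
  by rewrite (_ : 4 * r * _ = e) //; field; rewrite gt_eqF.
exists z => e e_gt0; have [K HK] := inv_small _ e_gt0; have [K' HK'] := pz _ e_gt0.
exists (p (maxn K K')); split; last by rewrite HK' // leq_maxr.
by move=> s s_in; rewrite (le_trans (fp _ s s_in)) // HK // leq_maxl.
Qed.

(** A product rule known for polynomials passes to their limits as soon as S is Lipschitz and h is
    bounded. *)
Lemma calc_mulr (h : R -> R) (S : V -> V) (B C : R) :
  (forall s, 0 <= s <= r -> `|h s| <= B) ->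
  (forall y z, n (S y - S z) <= C * n (y - z)) ->
  (forall p, calc (fun s => h s * p.[s]) (S (act D p a))) ->
  forall f z, calc f z -> calc (fun s => h s * f s) (S z).
Proof.
move=> hB SC Sp f z fz; apply: calc_lim => e e_gt0.
have K_gt0 : 0 < `|B| + `|C| + 1 by rewrite ltr_wpDl // addr_ge0.
have d_gt0 : 0 < e / (`|B| + `|C| + 1) by rewrite divr_gt0.
have dE : e = (`|B| + `|C| + 1) * (e / (`|B| + `|C| + 1)) by rewrite mulrC divfK
  // gt_eqF.
set d := e / _ in d_gt0 dE.
have [p [fp pz]] := fz _ d_gt0.
exists (fun s => h s * p.[s]), (S (act D p a)); split=> // [s s_in|].
  rewrite -mulrBr normrM; apply: (@le_trans _ _ (`|B| * d)).
    by rewrite ler_pM ?fp // (le_trans (hB s s_in)) // ler_norm.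
  by rewrite dE ler_wpM2r ?(ltW d_gt0) //; have := normr_ge0 C; lra.
rewrite (le_trans (SC _ _)) //; apply: (@le_trans _ _ (`|C| * d)).
  by rewrite (le_trans (ler_wpM2r (seminorm_ge0 sn _) (ler_norm C))) // ler_wpM2l.
by rewrite dE ler_wpM2r ?(ltW d_gt0) //; have := normr_ge0 B; lra.
Qed.

Lemma calc_bounded f z : calc f z ->
  exists B, forall s, 0 <= s <= r -> `|f s| <= B.
Proof.
move=> /(_ 1 ltr01) [p [fp _]].
have [B B_gt0 pB] := polylim_bounded r_ge0 (polylim_poly r p).
exists (1 + B) => s s_in; rewrite -(subrK p.[s] (f s)) (le_trans (ler_normD _ _)) //.
by rewrite lerD ?fp ?pB.
Qed.

(** The triple product is Lipschitz in each slot, so [calc_mulr] replaces the three polynomials by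
    limits one slot at a time. *)
Lemma calc_triple f g h x y z : calc f x -> calc g y -> calc h z ->
  calc (fun s => s * f s * g s * h s) (t x y z).
Proof.
have jt := pt_triple pt.
have [N tN] := pt_bounded pt.
have tBl u v v' w : t v u w - t v' u w = t (v - v') u w.
  have -> : v - v' = -1 *: v' + v by rewrite scaleN1r addrC.
  by rewrite (triple_linearl jt) scaleN1r addrC.
have tBm u v v' w : t u v w - t u v' w = t u (v - v') w.
  have -> : v - v' = -1 *: v' + v by rewrite scaleN1r addrC.
  by rewrite (triple_linearm jt) scaleN1r addrC.
have idB s : 0 <= s <= r -> `|s| <= r by move=> /andP[s0 sr]; rewrite ger0_norm.
move=> fx gy hz.
have [Bf fB] := calc_bounded fx; have [Bg gB] := calc_bounded gy.
have mulB f1 f2 B1 B2 : (forall s, 0 <= s <= r -> `|f1 s| <= B1) ->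
    (forall s, 0 <= s <= r -> `|f2 s| <= B2) ->
    forall s, 0 <= s <= r -> `|f1 s * f2 s| <= B1 * B2.
  by move=> f1B f2B s s_in; rewrite normrM ler_pM ?f1B ?f2B.
have polyB p : exists B, forall s, 0 <= s <= r -> `|p.[s]| <= B.
  exact: (calc_bounded (calc_poly p)).
have calc_ppp p q w : calc (fun s => s * p.[s] * q.[s] * w.[s])
    (t (act D p a) (act D q a) (act D w a)).
  rewrite (triple_act jt); apply: calc_eq (calc_poly _) => s _.
  by rewrite !hornerE; ring.
have calc_fpp p q : calc (fun s => s * f s * p.[s] * q.[s]) (t x (act D p a) (act
  D q a)).
  have [Bp pB] := polyB p; have [Bq qB] := polyB q.
  have := @calc_mulr (fun s => s * p.[s] * q.[s]) (fun v => t v (act D p a) (act D q a))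
    (r * Bp * Bq) (N * n (act D p a) * n (act D q a)) _ _ _ f x fx.
  move=> H; apply: calc_eq (H _ _ _) => [s _||v v'|w]; first by ring.
  - exact/mulB/qB/mulB.
  - by rewrite tBl; have := tN (v - v') (act D p a) (act D q a); lra.
  by apply: calc_eq (calc_ppp w p q) => s _; ring.
have calc_fgp p : calc (fun s => s * f s * g s * p.[s]) (t x y (act D p a)).
  have [Bp pB] := polyB p.
  have := @calc_mulr (fun s => s * f s * p.[s]) (fun v => t x v (act D p a))
    (r * Bf * Bp) (N * n x * n (act D p a)) _ _ _ g y gy.
  move=> H; apply: calc_eq (H _ _ _) => [s _||v v'|w]; first by ring.
  - exact/mulB/pB/mulB.
  - by rewrite tBm; have := tN x (v - v') (act D p a); lra.
  by apply: calc_eq (calc_fpp w p) => s _; ring.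
have := @calc_mulr (fun s => s * f s * g s) (fun v => t x y v)
    (r * Bf * Bg) (N * n x * n y) _ _ _ h z hz.
apply=> [|v v'|w].
- exact/mulB/gB/mulB.
- by rewrite !(triple_sym jt x y) tBl (triple_sym jt) tN.
exact: calc_fgp.
Qed.

End FunctionalCalculus.

(** * Comparison of norms *)

Section SmallNorm.
Context {R : realType} {V : lmodType R} (t : V -> V -> V -> V) (n m : V -> R).
Hypothesis pt : positive_triple t n.
Variables (a : V) (r M : R).

Let D : {linear V -> V} := triple_op (pt_triple pt) a a.
Let sn := pt_norm pt.

Hypothesis a1 : n a = 1.
Hypothesis r_ge1 : 1 <= r.
Hypothesis Dr : forall z, n (t a a z) <= r * n z.
Hypothesis sm : seminorm m.
Hypothesis m_eq0 : forall x, m x = 0 -> x = 0.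
Hypothesis m_triple : forall x y z, m (t x y z) <= M * m x * m y * m z.

Let a_le1 : n a <= 1. Proof. by rewrite a1. Qed.
Let r_ge0 : 0 <= r. Proof. by rewrite (le_trans ler01). Qed.

Let phi (f : limfun r) : V :=
  projT1 (cid (calc_exists pt a_le1 r_ge1 Dr (limfunP f))).

Let calc_phi (f : limfun r) : calc pt a r f (phi f).
Proof. by rewrite /phi; case: cid. Qed.

Let phi_eq (f : limfun r) z : calc pt a r f z -> phi f = z.
Proof. exact: (calc_unique a_le1 r_ge1 Dr (calc_phi f)). Qed.

(** Multiplication operators live on functions rather than on V; carrying m over to [limfun r] makes
    [power_bounded] applicable to them. *)
Let w (f : limfun r) : R := m (phi f).

Let phi_linear k (f g : limfun r) : phi (k *: f + g) = k *: phi f + phi g.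
Proof. by apply: phi_eq; apply: calc_linear; apply: calc_phi. Qed.

Let w_seminorm : seminorm w.
Proof.
have phi0 : phi 0 = 0.
  by have := phi_linear (-1) 0 0; rewrite !scaleN1r !addNr.
split=> [f g|k f]; rewrite /w.
  by rewrite -[f in phi (f + g)]scale1r phi_linear scale1r (seminormD sm).
by rewrite -[k *: f]addr0 phi_linear phi0 addr0 (seminormZ sm).
Qed.

Let calc_a : calc pt a r (fun=> 1) a.
Proof.
rewrite -{2}(act1 D a); apply: calc_eq (calc_poly pt a r 1) => s _.
by rewrite hornerC.
Qed.

(* Multiplication by s g(s) is L(phi g, a). *)
Let phi_mul (g f h : limfun r) : (forall s, h s = s * g s * f s) ->
  phi h = t (phi g) a (phi f).
Proof.
move=> hE; apply: phi_eq.
apply: calc_eq (calc_triple r_ge1 (calc_phi g) calc_a (calc_phi f)) => s _.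
by rewrite hE mulr1.
Qed.

Let w_mul (g f h : limfun r) : (forall s, h s = s * g s * f s) ->
  w h <= (M * m (phi g) * m a) * w f.
Proof. by move=> /phi_mul hE; rewrite /w hE; apply: m_triple. Qed.

Let floor_half (s : R) : R := Num.max `|s| 2^-1.
(** The factor 1/8 brings the multiplier s / max(|s|, 1/2)^2, bounded by 2, down to the threshold
    1/4 of [quadp_ge]. Writing [x] as s times [kernel] gives it the shape that [w_mul] requires. *)
Let kernel (s : R) : R := 8^-1 * (floor_half s ^+ 2)^-1.
Let x (s : R) : R := s * kernel s.

Let floor_half_gt0 s : 0 < floor_half s.
Proof. by rewrite lt_max invr_gt0 ltr0n orbT. Qed.

Let floor_half_lim : polylim r floor_half.
Proof. apply: polylim_max => //;
  [exact/polylim_norm/polylim_id|exact: polylim_cst]. Qed.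

Let kernel_lim : polylim r kernel.
Proof.
apply/polylimZ/(polylimV r_ge0 (c := 4^-1)) => // [s _|]; last exact: polylimX.
have : 2^-1 <= floor_half s by rewrite le_max lexx orbT.
by nra.
Qed.

Let x_lim : polylim r x.
Proof. by apply: polylimM => //; apply: polylim_id. Qed.

Let x_le s : `|x s| <= 4^-1.
Proof.
rewrite /x /kernel mulrA normrM normfV normrM [`|_ ^+ 2|]ger0_norm ?sqr_ge0 //.
rewrite ler_pdivrMr ?exprn_gt0 // [`|8^-1|]ger0_norm //.
have : 2^-1 <= floor_half s by rewrite le_max lexx orbT.
have : `|s| <= floor_half s by rewrite le_max lexx.
by have := normr_ge0 s; nra.
Qed.

Let x_inv s : 2^-1 <= s -> 8 * x s * s = 1.
Proof.
move=> s_ge; have s_gt0 : 0 < s by rewrite (lt_le_trans _ s_ge).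
have floorE : floor_half s = s.
  by rewrite /floor_half ger0_norm ?(ltW s_gt0) //; apply/max_idPl.
by rewrite /x /kernel floorE; field; rewrite gt_eqF.
Qed.

Let xf : limfun r := mk_limfun x_lim.
Let idf : limfun r := mk_limfun (polylim_id r).
Let X : {linear limfun r -> limfun r} := limfun_mul r_ge0 xf.
Let T : {linear limfun r -> limfun r} := limfun_mul r_ge0 idf.

(** The quadratic in X is multiplication by a function [q] >= 1/4, so its inverse is multiplication
    by 1/q; what has to be shown is that this inverse is bounded for [w]. *)
Let X_power_bounded : exists C, forall k f, w (act X 'X^k f) <= C * w f.
Proof.
apply: (power_bounded w_seminorm).
  exists (M * m (phi (mk_limfun kernel_lim)) * m a) => f.
  by apply: w_mul => s.
move=> al be al2 be2.
pose q s := 1 - 2 * al * x s + (al ^+ 2 + be ^+ 2) * x s ^+ 2.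
have q_ge s : 4^-1 <= q s by apply: quadp_ge.
have q_neq0 s : q s != 0 by rewrite gt_eqF // (lt_le_trans _ (q_ge s)).
have q_lim : polylim r q.
  apply: polylimD; last exact/polylimZ/polylimX.
  apply: polylimB; first exact: polylim_cst.
  exact: polylimZ.
have qV_lim : polylim r (fun s => (q s)^-1).
  by apply: (polylimV r_ge0 (c := 4^-1)).
have actE f s : act X (quadp al be 'X) f s = q s * f s.
  by rewrite act_limfun_mul /quadp /q !hornerE /=; ring.
pose U := limfun_mul r_ge0 (mk_limfun qV_lim).
have UE f s : U f s = (q s)^-1 * f s by [].
exists U; split.
(* 1/q - 1 = (1 - q)/q is divisible by x, hence by s, and [k2] is the quotient by s. The inverse is
   therefore the identity plus an operator covered by [w_mul]. *)
- pose k2 s := kernel s * (2 * al - (al ^+ 2 + be ^+ 2) * x s) * (q s)^-1.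
  have k2_lim : polylim r k2.
    apply: (polylimM r_ge0 _ qV_lim); apply: (polylimM r_ge0 kernel_lim).
    by apply: polylimB; [exact: polylim_cst|exact: polylimZ].
  exists (1 + M * m (phi (mk_limfun k2_lim)) * m a) => f.
  have g_lim : polylim r (fun s => s * k2 s * f s).
    apply: (polylimM r_ge0 _ (limfunP f)).
    exact: (polylimM r_ge0 (polylim_id r) k2_lim).
  have UfE : U f = f + mk_limfun g_lim.
    apply/val_inj/funext => s.
    rewrite -[LHS]/((q s)^-1 * f s) -[RHS]/(f s + s * k2 s * f s).
    by rewrite /k2; have := q_neq0 s; rewrite /q /x => ?; field.
  rewrite UfE (le_trans (seminormD w_seminorm _ _)) // mulrDl mul1r lerD //.
  exact: w_mul.
- move=> f; apply/val_inj/funext => s; apply: (etrans (actE _ _)).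
  by rewrite UE mulVKf.
move=> f; apply/val_inj/funext => s; apply: (etrans (UE _ _)).
by rewrite actE mulKf.
Qed.

Hypothesis ma_small : M * m a ^+ 2 <= 16^-1.

Let T_powers k f : w (act T 'X^k f) <= 16^-1 ^+ k * w f.
Proof.
elim: k => [|k IHk]; first by rewrite expr0 act1 mul1r.
rewrite exprSr actMX act_comm exprS -mulrA.
have TE h : phi (T h) = t a a (phi h).
  apply: phi_eq; apply: calc_eq (calc_triple r_ge1 calc_a calc_a (calc_phi h)) => s _.
  by rewrite !mulr1.
rewrite {1}/w TE (le_trans (m_triple _ _ _)) // -mulrA.
apply: (@le_trans _ _ (16^-1 * w (act T 'X^k f))); last by rewrite ler_wpM2l.
rewrite mulrA; apply: ler_wpM2r; first exact: seminorm_ge0.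
by rewrite -mulrA -expr2.
Qed.

(** On the support of f one has 8 x(s) s = 1, so f = 8^j X^j T^j f. The factor 16^-j from T^j
    against 8^j leaves w f <= C 2^-j w f, which forces w f = 0. *)
Let phi_eq0 (f : limfun r) : (forall s, s < 2^-1 -> f s = 0) -> phi f = 0.
Proof.
move=> f0; apply: m_eq0; rewrite -/(w f); apply/le_anti.
rewrite (seminorm_ge0 w_seminorm) andbT.
have [C C_ge0 HC] : exists2 C, 0 <= C & forall k f, w (act X 'X^k f) <= C * w f.
  have [C0 HC0] := X_power_bounded.
  exists (Num.max C0 0); first by rewrite le_max lexx orbT.
  move=> k h; rewrite (le_trans (HC0 k h)) // ler_wpM2r ?le_max ?lexx //.
  exact: (seminorm_ge0 w_seminorm).
have fE j : f = 8 ^+ j *: act X 'X^j (act T 'X^j f).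
  apply/val_inj/funext => s; rewrite -[RHS]/(8 ^+ j * act X 'X^j (act T 'X^j f) s).
  rewrite /= !act_limfun_mul !hornerXn /= !mulrA -!exprMn.
  have [/f0 ->|/x_inv ->] := ltP s 2^-1; first by rewrite mulr0.
  by rewrite expr1n mul1r.
have w_le j : w f <= C * 2^-1 ^+ j * w f.
  rewrite {1}(fE j) (seminormZ w_seminorm) ger0_norm ?exprn_ge0 //.
  have -> : 2^-1 = 8 * 16^-1 :> R by lra.
  rewrite exprMn mulrCA -mulrA ler_wpM2l ?exprn_ge0 // (le_trans (HC _ _)) //.
  by rewrite -mulrA ler_wpM2l.
have [j] : exists j, C * 2^-1 ^+ j <= 2^-1 by apply: geometric_small; lra.
by have := w_le j; have := seminorm_ge0 w_seminorm f; nra.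
Qed.

Lemma norm_not_small : False.
Proof.
have r_gt0 : 0 < 4 * r by rewrite mulr_gt0 // (lt_le_trans ltr01).
have [|||j Hj] := @geometric_small R (3 / 4) (4 * r) 2^-1; [lra|exact: ltW|lra|].
have [e /andP[le_je _]] := odd_powers_norm pt a 1 j.
rewrite expr1n mul1r act_Xn act1 a1 expr1n => n_pow.
(* A cut-off equal to 0 up to 1/2 and to 1 from 3/4 on. *)
pose u s : R := Num.min 1 (4 * Num.max 0 (s - 2^-1)).
have u_lim : polylim r u.
  apply: polylim_min => //; first exact: polylim_cst.
  apply/polylimZ; apply: polylim_max => //; first exact: polylim_cst.
  by apply: polylimB; [apply: polylim_id|apply: polylim_cst].
have F_lim : polylim r (fun s => s ^+ e * u s).
  by apply: polylimM => //; apply/polylimX/polylim_id.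
have F0 : phi (mk_limfun F_lim) = 0.
  apply: phi_eq0 => s s_lt; rewrite -[LHS]/(s ^+ e * u s) /u.
  have /max_idPl -> : s - 2^-1 <= 0 by lra.
  by rewrite mulr0 min_r // mulr0.
have := calc_phi (mk_limfun F_lim); rewrite F0 => calcF.
have calc_pow : calc pt a r (fun s => s ^+ e) (iter e D a).
  rewrite -act_Xn; apply: calc_eq (calc_poly pt a r 'X^e) => s _.
  by rewrite hornerXn.
(* As s^e u(s) is sent to 0, D^e a is also the value of the calculus at s^e (1 - u(s)), a function
   bounded by (3/4)^e on [0, r]; yet D^e a has norm 1. *)
have := calc_linear (-1) calcF calc_pow.
rewrite scaler0 add0r => /(calc_bound a_le1 r_ge1 Dr (B := (3 / 4) ^+ e)).
rewrite n_pow => n_le.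
have n_le' : 1 <= 4 * r * (3 / 4) ^+ e.
  apply: n_le; first by rewrite exprn_gt0.
  move=> s /andP[s_ge0 _]; rewrite -[mk_limfun F_lim s]/(s ^+ e * u s).
  have -> : -1 * (s ^+ e * u s) + s ^+ e = s ^+ e * (1 - u s) by ring.
  have u_le1 : u s <= 1 by rewrite ge_min lexx.
  have [s_le|s_gt] := leP s (3 / 4).
    have u_ge0 : 0 <= u s by rewrite le_min ler01 mulr_ge0 // le_max lexx.
    rewrite normrM -[leRHS]mulr1 ler_pM // ger0_norm ?exprn_ge0 //.
      by rewrite lerXn2r ?nnegrE.
    by lra.
    by lra.
  have -> : u s = 1.
    rewrite /u min_l //; have : s - 2^-1 <= Num.max 0 (s - 2^-1).
      by rewrite le_max lexx orbT.
    by lra.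
  by rewrite subrr mulr0 normr0 exprn_ge0.
have : (3 / 4) ^+ e <= (3 / 4) ^+ j :> R by rewrite ler_wiXn2l //; lra.
by move: n_le' Hj; nra.
Qed.

End SmallNorm.

Lemma norm_dominates (R : realType) (V : lmodType R) (t : V -> V -> V -> V)
    (n m : V -> R) (M : R) :
  positive_triple t n -> seminorm m -> (forall x, m x = 0 -> x = 0) ->
  (forall x y z, m (t x y z) <= M * m x * m y * m z) ->
  exists c, 0 < c /\ forall x, c * n x <= m x.
Proof.
move=> pt sm m_eq0 mt; have sn := pt_norm pt; have [N nt] := pt_bounded pt.
pose M' := Num.max M 1; have M'_ge1 : 1 <= M' by rewrite le_max lexx orbT.
have mt' x y z : m (t x y z) <= M' * m x * m y * m z.
  rewrite (le_trans (mt x y z)) // !ler_wpM2r ?(seminorm_ge0 sm) //.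
  by rewrite le_max lexx.
(* Then M' c^2 = c/4 <= 1/16 because M' >= 1, the smallness under which [norm_not_small] is
   contradictory. *)
pose c := (4 * M')^-1; have cM : 4 * c * M' = 1.
  by rewrite /c; field; rewrite gt_eqF // (lt_le_trans ltr01).
have c_gt0 : 0 < c by rewrite invr_gt0 mulr_gt0 // (lt_le_trans ltr01).
exists c; split=> // x.
have [nx0|nx_neq0] := eqVneq (n x) 0.
  by rewrite nx0 mulr0 seminorm_ge0.
have nx_gt0 : 0 < n x by rewrite lt_def nx_neq0 seminorm_ge0.
pose a := (n x)^-1 *: x.
have na1 : n a = 1 by rewrite (seminormZ sn) gtr0_norm ?invr_gt0 // mulVf.
have ma : m a = (n x)^-1 * m x by rewrite (seminormZ sm) gtr0_norm ?invr_gt0.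
have [|ma_lt] := leP c (m a).
  by rewrite ma ler_pdivlMl // mulrC.
case: (@norm_not_small _ _ t n m pt a (Num.max N 1) M') => //.
- by rewrite le_max lexx orbT.
- move=> z; rewrite (le_trans (nt a a z)) // na1 !mulr1.
  by rewrite ler_wpM2r ?(seminorm_ge0 sn) // le_max lexx.
have ma_ge0 := seminorm_ge0 sm a.
have c_le : c <= 4^-1 by nra.
apply: (@le_trans _ _ (M' * (c * c))); last by rewrite mulrA; nra.
rewrite ler_wpM2l ?(le_trans ler01) // expr2.
by apply: ler_pM => //; exact: ltW.
Qed.

(** * Real and complex triples *)

Lemma dominated_bounded_below (R : realType) (V W : lmodType R)
    (tV : V -> V -> V -> V) (tW : W -> W -> W -> W) (nV : V -> R) (nW : W -> R)
    (T : V -> W) (M : R) :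
  positive_triple tV nV -> seminorm nW -> (forall x, nW x = 0 -> x = 0) ->
  (forall x y z, nW (tW x y z) <= M * nW x * nW y * nW z) ->
  linear T -> triple_monomorphism tV tW T -> bounded_below nV nW T.
Proof.
move=> pt sW W_eq0 tW_le T_lin [T_inj T_hom].
have T0 : T 0 = 0.
  by have := T_lin (-1) 0 0; rewrite !scaleN1r !addNr.
apply: (norm_dominates (m := nW \o T) (M := M) pt) => [|x /W_eq0|x y z] /=.
- split=> [x y|k x] /=.
    by rewrite -[x in T (x + y)]scale1r T_lin scale1r (seminormD sW).
  by rewrite -[k *: x]addr0 T_lin T0 addr0 (seminormZ sW).
- by rewrite -T0 => /T_inj.
by rewrite T_hom.
Qed.

(** * Boundedness of a continuous triple product, for both scalar fields *)

Section NormedTriple.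
Context {K : numFieldType} (conj : K -> K) {E : normedModType K}.
Context (tp : E -> E -> E -> E).
Hypothesis njt : normed_jordan_triple conj tp.
Hypothesis conj_ge0 : forall k, 0 <= k -> conj k = k.

Lemma njt0l y z : tp 0 y z = 0.
Proof.
have := njt_outer_linear njt 1 0 0 y z; rewrite !scale1r addr0 => /eqP.
by rewrite -subr_eq0 opprD addrA subrr sub0r oppr_eq0 => /eqP.
Qed.

Lemma njt0m x z : tp x 0 z = 0.
Proof.
have := njt_middle_linear njt 1 x 0 0 z; rewrite conj_ge0 // !scale1r addr0 => /eqP.
by rewrite -subr_eq0 opprD addrA subrr sub0r oppr_eq0 => /eqP.
Qed.

Lemma njt_scalel k x y z : tp (k *: x) y z = k *: tp x y z.
Proof. by rewrite -[k *: x]addr0 (njt_outer_linear njt) njt0l addr0. Qed.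

Lemma njt_scalem k x y z : 0 <= k -> tp x (k *: y) z = k *: tp x y z.
Proof.
by move=> k0; rewrite -[k *: y]addr0 (njt_middle_linear njt) njt0m addr0 conj_ge0.
Qed.

(** Continuity at the origin and rescaling of each variable. The scaling factors are nonnegative, so
    the involution fixes them even in the middle slot. *)
Lemma njt_bounded : exists M, forall x y z, `|tp x y z| <= M * `|x| * `|y| * `|z|.
Proof.
have : tp 0 0 0 = 0 := njt0l 0 0.
have := njt_continuous njt; move=> /(_ (0, 0, 0)) /cvgrPdist_lt /(_ 1 ltr01).
move=> /= /nbhs_ballP [e /= e_gt0 he] t0.
pose d := e / 2; have d_gt0 : 0 < d by rewrite divr_gt0.
have small x y z : `|x| <= d -> `|y| <= d -> `|z| <= d -> `|tp x y z| <= 1.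
  move=> xd yd zd; have := he (x, y, z); rewrite /= t0 sub0r normrN => /(_ _)/ltW;
    apply.
  by split; [split|]; rewrite -ball_normE /= sub0r normrN (le_lt_trans _ (midf_lt
    e_gt0).2) // add0r.
exists (d^-1 ^+ 3) => x y z.
have [->|x_neq0] := eqVneq x 0; first by rewrite njt0l !normr0 !(mulr0, mul0r).
have [->|y_neq0] := eqVneq y 0; first by rewrite njt0m !normr0 !(mulr0, mul0r).
have [->|z_neq0] := eqVneq z 0.
  by rewrite (njt_outer_sym njt) njt0l !normr0 !(mulr0, mul0r).
have scaled (u : E) : u != 0 -> `|(d / `|u|) *: u| <= d.
  move=> u0; rewrite normrZ normrM normfV normr_id divfK ?normr_eq0 //.
  by rewrite gtr0_norm.
have scale_ge0 (u : E) : 0 <= d / `|u| by rewrite divr_ge0 // ltW.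
have := small _ _ _ (scaled x x_neq0) (scaled y y_neq0) (scaled z z_neq0).
rewrite njt_scalel njt_scalem // (njt_outer_sym njt) njt_scalel.
rewrite (njt_outer_sym njt z y) !scalerA normrZ.
rewrite (ger0_norm (mulr_ge0 (mulr_ge0 (scale_ge0 x) (scale_ge0 y)) (scale_ge0 z))).
move=> H.
have x_gt0 : 0 < `|x| by rewrite normr_gt0.
have y_gt0 : 0 < `|y| by rewrite normr_gt0.
have z_gt0 : 0 < `|z| by rewrite normr_gt0.
have k_gt0 : 0 < d / `|x| * (d / `|y|) * (d / `|z|) by rewrite !(mulr_gt0, invr_gt0).
rewrite -(ler_pM2l k_gt0) (le_trans H) //.
by rewrite le_eqVlt; apply/orP; left; apply/eqP; field; rewrite !gt_eqF.
Qed.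

End NormedTriple.

Lemma cauchy_seq_lim (K : numFieldType) (E : completeNormedModType K) (u : nat -> E) :
  (forall e, 0 < e ->
     exists k, forall i j, (k <= i)%N -> (k <= j)%N -> `|u i - u j| <= e) ->
  exists l, forall e, 0 < e -> exists k, forall i, (k <= i)%N -> `|u i - l| <= e.
Proof.
move=> cu.
have : cvg (u @ \oo).
  apply: cauchy_cvg; apply: cauchy_exP => e e_gt0.
  have [k uk] := cu _ (divr_gt0 e_gt0 (ltr0n _ 2)); exists (u k), k => // i /= ki.
  rewrite -ball_normE /= (le_lt_trans (uk k i _ ki)) //.
  by rewrite ltr_pdivrMr // ltr_pMr // ltr1n.
move=> /cvgrPdist_le ul; exists (lim (u @ \oo)) => e /ul [k _ Hk].
by exists k => i ki; rewrite distrC; apply: Hk.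
Qed.

Section LinearFunctions.
Context {K : nzRingType} {U V : lmodType K} (f : U -> V).
Hypothesis f_lin : linear f.

Lemma linear_fun0 : f 0 = 0.
Proof. by have := f_lin (-1) 0 0; rewrite !scaleN1r !addNr. Qed.

Lemma linear_funZ k x : f (k *: x) = k *: f x.
Proof. by rewrite -[k *: x]addr0 f_lin linear_fun0 addr0. Qed.

Lemma linear_funD x y : f (x + y) = f x + f y.
Proof. by rewrite -[x in LHS]scale1r f_lin scale1r. Qed.

Lemma linear_funN x : f (- x) = - f x.
Proof. by rewrite -scaleN1r linear_funZ scaleN1r. Qed.

End LinearFunctions.

(** * Real triples: from the complexified spectrum to real quadratics *)

Section RealTriples.
Context {R : realType}.

Lemma norm_seminorm (E : normedModType R) : seminorm (fun x : E => `|x|).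
Proof. by split=> [x y|k x]; [apply: ler_normD|apply: normrZ]. Qed.

Lemma real_jordan_triple (E : normedModType R) (tp : E -> E -> E -> E) :
  real_normed_jordan_triple tp -> jordan_triple tp.
Proof.
move=> h; split; [exact: (njt_outer_sym h)|exact: (njt_outer_linear h)|
  exact: (njt_middle_linear h)|exact: (njt_jordan h)].
Qed.

(** Let A + i B invert W + i be, where W = al - S. Formally the inverse is (W - i be)/(W^2 + be^2),
    so -B/be inverts W^2 + be^2, which is the quadratic in S. *)
Lemma real_spectrum_nonneg (E : normedModType R) (S : {linear E -> E}) :
  (forall l, real_spectrum S l -> 0 <= l) ->
  nonneg_spectrum (fun x : E => `|x|) S.
Proof.
move=> pos.
have actE al z : act S ('X - al%:P) z = S z - al *: z by rewrite actB actX actC.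
have inv l : ~ 0 <= l -> cpl_invertible
    (fun x => complex.Re l *: x - S x, fun x => complex.Im l *: x).
  by move=> l_neg; apply: contrapT => H; apply/l_neg/pos.
split=> [al al_lt0|al be be_neq0].
  have [|[A B] [/= [A_lin [M AM]] [B_lin _] [SA _] [AS _]]] := inv al%:C.
    by rewrite lecR => /(lt_le_trans al_lt0); rewrite ltxx.
  exists (fun x => - A x); split => [|x|x].
  - by exists M => x; rewrite normrN.
  - rewrite actE; have := congr1 (@^~ x) SA; rewrite /= scale0r subr0 => SAx;
    rewrite -[RHS]SAx.
    by rewrite (linearN S) scalerN opprK addrC.
  have := congr1 (@^~ x) AS; rewrite /= scale0r (linear_fun0 B_lin) subr0 => ASx.
  by rewrite actE -(linear_funN A_lin) opprB -[RHS]ASx.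
have [|[A B] [/= [A_lin [M AM]] [B_lin [M' BM]] [WA WB] [AW BW]]] := inv (al +i* be).
  by rewrite lecE /= (negPf be_neq0).
pose W : {linear E -> E} := act S (al%:P - 'X).
have WE x : W x = al *: x - S x by rewrite /W /= actB actC actX.
have WAE x : W (A x) = x + be *: B x.
  by apply/eqP; rewrite -subr_eq WE; apply/eqP; exact: (congr1 (@^~ x) WA).
have WBE x : W (B x) = - (be *: A x).
  by apply/eqP; rewrite WE -addr_eq0; apply/eqP; exact: (congr1 (@^~ x) WB).
have AWE x : A (W x) = x + be *: B x.
  apply/eqP; rewrite -subr_eq WE -(linear_funZ B_lin); apply/eqP.
  exact: (congr1 (@^~ x) AW).
have BWE x : B (W x) = - (be *: A x).
  apply/eqP; rewrite WE -addr_eq0 addrC -(linear_funZ A_lin); apply/eqP.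
  exact: (congr1 (@^~ x) BW).
have quadE x : act S (('X - al%:P) ^+ 2 + (be ^+ 2)%:P) x = W (W x) + be ^+ 2 *: x.
  by rewrite /W /= -actM -(actC S) -actD; congr (act _ _ x); ring.
have inner x : - (be *: (x + be *: B x)) + be ^+ 2 *: B x = - (be *: x).
  by rewrite scalerDr scalerA -expr2 opprD subrK.
have cancel_be x : - be^-1 *: (- (be *: x)) = x.
  by rewrite scalerN scaleNr opprK scalerA mulVf // scale1r.
exists (fun x => - be^-1 *: B x); split => [|x|x].
- exists (`|be^-1| * M') => x; rewrite normrZ normrN -mulrA ler_wpM2l //.
- rewrite linearZ /= quadE WBE linearN linearZ /= WAE.
  by rewrite inner cancel_be.
rewrite quadE (linear_funD B_lin) BWE AWE (linear_funZ B_lin).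
by rewrite inner cancel_be.
Qed.

Lemma JstarB_positive (E : completeNormedModType R) (tp : E -> E -> E -> E) :
  JstarB_triple tp -> positive_triple tp (fun x : E => `|x|).
Proof.
move=> h; have njt := jsb_triple h.
apply: (PositiveTriple (pt_triple := real_jordan_triple njt)).
- exact: norm_seminorm.
- by move=> x /normr0_eq0.
- exact: cauchy_seq_lim.
- exact: njt_bounded njt _.
- exact: jsb_cube h.
by move=> a; apply: real_spectrum_nonneg => l; apply: (jsb_positive h).
Qed.

End RealTriples.

(** * Complex triples by restriction of scalars *)

Section ComplexTriples.
Context {R : realType}.

(** A separate name for E keeps its structure of real vector space apart from the complex one. *)
Definition realified (E : normedModType R[i]) : Type := E.

HB.instance Definition _ (E : normedModType R[i]) :=
  GRing.Zmodule.on (realified E).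

Section Realified.
Variable E : normedModType R[i].

Let scaleA (k l : R) (x : realified E) :
  real_scale k (real_scale l x) = real_scale (k * l) x.
Proof. by rewrite /real_scale scalerA -rmorphM. Qed.

Let scale1 : left_id 1 (@real_scale R E).
Proof. by move=> x; rewrite /real_scale rmorph1 scale1r. Qed.

Let scaleDr : right_distributive (@real_scale R E) +%R.
Proof. by move=> k x y; rewrite /real_scale scalerDr. Qed.

Let scaleDl (x : realified E) : {morph (@real_scale R E)^~ x : k l / k + l}.
Proof. by move=> k l; rewrite /real_scale rmorphD scalerDl. Qed.

HB.instance Definition _ := GRing.Zmodule_isLmodule.Build R (realified E)
  scaleA scale1 scaleDr scaleDl.

End Realified.

Lemma normc_cnorm (E : normedModType R[i]) (x : E) : `|x| = (cnorm x)%:C.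
Proof. by rewrite /cnorm RRe_real // ger0_real. Qed.

Lemma cnorm_seminorm (E : normedModType R[i]) :
  seminorm (@cnorm R E : realified E -> R).
Proof.
split=> [x y|k x].
  by rewrite -lecR rmorphD /= -!normc_cnorm ler_normD.
apply: complexI; rewrite -normc_cnorm rmorphM /= -normc_cnorm.
by rewrite -[k *: x]/(k%:C *: (x : E)) normrZ normc_def /= expr0n /= addr0
  sqrtr_sqr normc_cnorm.
Qed.

Lemma cnorm_eq0 (E : normedModType R[i]) (x : E) : cnorm x = 0 -> x = 0.
Proof. by move=> x0; apply/normr0_eq0; rewrite normc_cnorm x0. Qed.

Lemma complex_jordan_triple (E : normedModType R[i]) (tp : E -> E -> E -> E) :
  complex_normed_jordan_triple tp ->
  jordan_triple (tp : realified E -> realified E -> realified E -> realified E).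
Proof.
move=> h; split; [exact: (njt_outer_sym h)|move=> k *; exact: (njt_outer_linear h)|
  |exact: (njt_jordan h)].
by move=> k *; rewrite (njt_middle_linear h) /= oppr0.
Qed.

Lemma complex_njt_bounded (E : normedModType R[i]) (tp : E -> E -> E -> E) :
  complex_normed_jordan_triple tp ->
  exists M, forall x y z, cnorm (tp x y z) <= M * cnorm x * cnorm y * cnorm z.
Proof.
move=> h; have [|M tM] := njt_bounded h.
  by case=> k l; rewrite lecE /= => /andP[/eqP -> _]; rewrite oppr0.
exists (complex.Re M) => x y z; have := tM x y z.
rewrite !normc_cnorm -!mulrA -!rmorphM /= lecE => /andP[_] /=.
by case: M {tM} => M1 M2 /=; rewrite mulr0 subr0.
Qed.

Lemma cnorm_complete (E : completeNormedModType R[i]) :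
  complete_norm (@cnorm R E : realified E -> R).
Proof.
move=> u cu; have [|l ul] := @cauchy_seq_lim _ E u.
  move=> e; rewrite ltcE /= => /andP[/eqP e_im e_gt0].
  have [k uk] := cu _ e_gt0; exists k => i j ki kj.
  by rewrite normc_cnorm lecE /= e_im eqxx /= uk.
exists l => e e_gt0; have [|k Hk] := ul e%:C; first by rewrite ltcR.
by exists k => i ki; rewrite -lecR -normc_cnorm Hk.
Qed.

(** The real quadratic factors as (l - S)(conj l - S) with l = al + i be non-real; neither point
    lies in the spectrum, and the two inverses compose. With B = al - S the factors read B + i be
    and B - i be. *)
Lemma complex_spectrum_nonneg (E : normedModType R[i]) (S : {linear E -> E})
    (S' : {linear realified E -> realified E}) :
  S =1 S' -> (forall l, complex_spectrum S l -> 0 <= l) ->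
  nonneg_spectrum (@cnorm R E : realified E -> R) S'.
Proof.
move=> SS' pos.
have inv l : ~ 0 <= l -> exists U : E -> E, bounded_operator U /\
    (forall x, l *: U x - S (U x) = x) /\ (forall x, U (l *: x - S x) = x).
  by move=> l_neg; apply: contrapT => H; apply/l_neg/pos.
have bd (U : E -> E) : bounded_operator U ->
    op_bounded (@cnorm R E : realified E -> R) U.
  case=> _ [M UM]; exists (complex.Re M) => x; have := UM x.
  rewrite !normc_cnorm lecE => /andP[_] /=.
  by case: M {UM} => M1 M2 /=; rewrite mulr0 subr0.
have actE (al : R) (z : E) : act S' ('X - al%:P) z = S z - al%:C *: z.
  by rewrite actB actX actC SS'.
split=> [al al_lt0|al be be_neq0].
  have [|U [U_op [SU US]]] := inv al%:C.
    by rewrite lecR => /(lt_le_trans al_lt0); rewrite ltxx.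
  have [M UM] := bd _ U_op; have [U_lin _] := U_op.
  exists (fun x => - U x); split => [|x|x].
  - by exists M => x; rewrite (seminormN (cnorm_seminorm E)).
  - by rewrite actE linearN scalerN opprK addrC SU.
  by rewrite actE -(linear_funN U_lin) opprB US.
have im_neg (d : R) : d != 0 -> ~ 0 <= al +i* d.
  by move=> d0; rewrite lecE /= (negPf d0).
have [U [U_op [SU US]]] := inv _ (im_neg _ be_neq0).
have [|U' [U'_op [SU' US']]] := inv (al -i* be).
  by apply: im_neg; rewrite oppr_eq0.
have [B BE] : exists B : E -> E, forall w, B w = al%:C *: w - S w by eexists.
have BZ k w : B (k *: w) = k *: B w.
  have SZ : S (k *: w) = k *: S w by rewrite linearZ.
  by rewrite !BE SZ scalerBr !scalerA [k * _]mulrC.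
have BB u v : B (u - v) = B u - B v.
  by rewrite !BE (linearB S) scalerBr [- (S u - S v)]opprD addrACA -opprD.
pose ib : R[i] := 0 +i* be.
have AE w : (al +i* be) *: w - S w = B w + ib *: w.
  rewrite BE addrAC -scalerDl; congr (_ *: _ - _).
  by rewrite /ib; simpc.
have A'E w : (al -i* be) *: w - S w = B w - ib *: w.
  rewrite BE addrAC -scalerBl; congr (_ *: _ - _).
  by rewrite /ib; simpc.
have quadE (z : E) : act S' (('X - al%:P) ^+ 2 + (be ^+ 2)%:P) z =
    B (B z - ib *: z) + ib *: (B z - ib *: z).
  have Q2 : act S' (('X - al%:P) ^+ 2) z = B (B z).
    by rewrite actM !actE !BE -[S z - _]opprB linearN scalerN opprK addrC.
  have ib2 : ib * ib = - (be ^+ 2)%:C by rewrite /ib; simpc; congr (_ +i* _); ring.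
  rewrite actD actC Q2 (BB _ (ib *: z)) (BZ ib z) [ib *: (_ - _)]scalerBr.
  rewrite [ib *: (ib *: _)]scalerA ib2 scaleNr opprK.
  by rewrite addrA subrK.
exists (U' \o U); split.
- by apply: (op_bounded_comp (cnorm_seminorm E)); apply: bd.
- by move=> z; rewrite quadE -A'E /= SU' -AE SU.
by move=> z; rewrite quadE -A'E -AE /= US US'.
Qed.

Lemma JBstar_positive (E : completeNormedModType R[i]) (tp : E -> E -> E -> E) :
  JBstar_triple tp ->
  positive_triple (tp : realified E -> realified E -> realified E -> realified E)
    (@cnorm R E).
Proof.
move=> h; have njt := jbs_triple h.
apply: (PositiveTriple (pt_triple := complex_jordan_triple njt)).
- exact: cnorm_seminorm.
- exact: cnorm_eq0.
- exact: cnorm_complete.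
- exact: complex_njt_bounded.
- move=> x; apply: complexI; rewrite rmorphXn /= -!normc_cnorm; exact: jbs_cube h x.
move=> a; pose S : E -> E := tp a a.
have [S_lin _] : bounded_operator S by case: (jbs_hermitian h a).
pose L : {linear E -> E} := HB.pack S (GRing.isLinear.Build _ _ _ _ S S_lin).
by apply: (@complex_spectrum_nonneg _ L) => // l; apply: (jbs_positive h).
Qed.

End ComplexTriples.

Theorem theorem17 (R : realType) :
  (forall (E : completeNormedModType R[i]) (tE : E -> E -> E -> E)
     (F : normedModType R[i]) (tF : F -> F -> F -> F) (T : E -> F),
     JBstar_triple tE -> complex_normed_jordan_triple tF ->
     linear T -> triple_monomorphism tE tF T ->
     bounded_below (@cnorm R E) (@cnorm R F) T) /\
  (forall (E : completeNormedModType R[i]) (tE : E -> E -> E -> E)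
     (F : normedModType R) (tF : F -> F -> F -> F) (T : E -> F),
     JBstar_triple tE -> real_normed_jordan_triple tF ->
     real_linear (@real_scale R E) (fun r (y : F) => r *: y) T ->
     triple_monomorphism tE tF T ->
     bounded_below (@cnorm R E) (fun y : F => `|y|) T) /\
  (forall (E : completeNormedModType R) (tE : E -> E -> E -> E)
     (F : normedModType R) (tF : F -> F -> F -> F) (T : E -> F),
     JstarB_triple tE -> real_normed_jordan_triple tF ->
     linear T -> triple_monomorphism tE tF T ->
     bounded_below (fun x : E => `|x|) (fun y : F => `|y|) T) /\
  (forall (E : completeNormedModType R) (tE : E -> E -> E -> E)
     (F : normedModType R[i]) (tF : F -> F -> F -> F) (T : E -> F),
     JstarB_triple tE -> complex_normed_jordan_triple tF ->
     real_linear (fun r (x : E) => r *: x) (@real_scale R F) T ->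
     triple_monomorphism tE tF T ->
     bounded_below (fun x : E => `|x|) (@cnorm R F) T).
Proof.
have complex_bound (F : normedModType R[i]) tF := @complex_njt_bounded R F tF.
have real_bound (F : normedModType R) tF (h : @real_normed_jordan_triple R F tF) :=
  njt_bounded h (fun k _ => erefl k).
split; [|split; [|split]] => E tE F tF T /[dup] hE.
- move=> /JBstar_positive ptE /complex_bound[M tF_le] T_lin T_mono.
  apply: (@dominated_bounded_below R (realified E) (realified F) tE tF _ _ T M ptE).
  + exact: cnorm_seminorm.
  + exact: cnorm_eq0.
  + exact: tF_le.
  + by move=> k x y; apply: T_lin.
  + exact: T_mono.
- move=> /JBstar_positive ptE /real_bound[M tF_le] T_lin T_mono.
  apply: (@dominated_bounded_below R (realified E) F tE tF _ _ T M ptE).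
  + exact: norm_seminorm.
  + exact: normr0_eq0.
  + exact: tF_le.
  + by move=> k x y; apply: T_lin.
  + exact: T_mono.
- move=> /JstarB_positive ptE /real_bound[M tF_le] T_lin T_mono.
  apply: (@dominated_bounded_below R E F tE tF _ _ T M ptE).
  + exact: norm_seminorm.
  + exact: normr0_eq0.
  + exact: tF_le.
  + by move=> k x y; apply: T_lin.
  + exact: T_mono.
move=> /JstarB_positive ptE /complex_bound[M tF_le] T_lin T_mono.
apply: (@dominated_bounded_below R E (realified F) tE tF _ _ T M ptE).
+ exact: cnorm_seminorm.
+ exact: cnorm_eq0.
+ exact: tF_le.
+ by move=> k x y; apply: T_lin.
+ exact: T_mono.
Qed.
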